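(* Let $p$ be a path in $K\Gamma$ with starting vertex $e(1)$, let $w_1,\dots,w_t$ be the right subpaths of positive length of $p$ which end in $e(1)$, and let $Z=(Z_1,\dots,Z_t)$. For $k,k'\in V_p$, the linear system $S_p(k,k',Z)$ (over $K$, in the unknowns $Z_1,\dots,Z_t$) is consistent if and only if $\Phi_p(k)\cong\Phi_p(k')$.
   Context: Setting. $K$ is an arbitrary field, $\Gamma$ a finite quiver, $I$ an admissible ideal of the path algebra $K\Gamma$, and $\Lambda=K\Gamma/I$, a finite dimensional algebra with Jacobson radical $J$ and Loewy length $L$ (the least integer with $J^L=0$). Vertices of $\Gamma$ are identified with the corresponding primitive idempotents (paths of length $0$). The product $qp$ of paths means ''$q$ after $p$'' (and is $0$ if this is not defined). Modules are left modules. A path of $K\Gamma$ and its residue class in $\Lambda$ are denoted by the same symbol. A path $v$ is a right subpath of $p$ if $p=wv$ for some path $w$ (lengths $0$ allowed). A mast of a uniserial $\Lambda$-module $U$ of composition length $l+1$ is a path $p$ of length $l$ in $K\Gamma$ with $pU\neq0$. Detours. A detour on a path $p$ is a pair $(\alpha,u)$, where $\alpha$ is an arrow and $u$ is a right subpath of $p$ (length $0$ allowed) such that (i) $\alpha u\ne0$ in $K\Gamma$; (ii) $\alpha u$ is not a right subpath of $p$; (iii) there is a right subpath $v$ of $p$ with $\mathrm{length}(v)\ge\mathrm{length}(u)+1$ whose endpoint equals the endpoint of $\alpha$. One writes $(\alpha,u)\wr\wr p$. For a detour $(\alpha,u)$ on $p$, $\{v_i(\alpha,u)\mid i\in I(\alpha,u)\}$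 is the family (indexed without repetition by the finite set $I(\alpha,u)$) of all right subpaths of $p$ that are longer than $u$ and have the same endpoint as $\alpha$. Routes. If $p$ passes consecutively through the vertices $e(1),\dots,e(l+1)$, a route on $p$ is a path in $K\Gamma$ (possibly $e(1)$ itself) which starts in $e(1)$ and whose sequence of consecutive vertices is a subsequence of $(e(1),\dots,e(l+1))$. The variety $V_p$. Let $X$ be the family of independent commuting variables $X_i(\alpha,u)$, $(\alpha,u)\wr\wr p$, $i\in I(\alpha,u)$, let $K[X]$ be the polynomial ring over $K$ and $K\Gamma[X]$ the polynomial ring with coefficients in $K\Gamma$. Let $\mathcal L(p)$ be the left ideal of $K\Gamma[X]$ generated by all paths that are not routes on $p$ together with all differences $\alpha u-\sum_{i\in I(\alpha,u)}X_i(\alpha,u)v_i(\alpha,u)$ for $(\alpha,u)\wr\wr p$. Each $z\in K\Gamma$ is congruent modulo $\mathcal L(p)$ to a unique element $\sum_{p'}\tau_{p'}(X)p'$ with $\tau_{p'}(X)\in K[X]$, where $p'$ runs through the right subpaths of $p$. Let $I^{(L)}$ be the $K$-subspace of $I$ consisting of those elements that are $K$-linear combinations of paths of length at most $L$, let $t_1,\dots,t_s$ be a $K$-spanning set of $I^{(L)}$, and let $\tau_{j,p'}(X)$ be the resulting polynomials for $t_j$. Then $V_p$ is the simultaneous vanishing locus of all $\tau_{j,p'}(X)$ in affine space $\mathbb A^N(K)$, $N=\sum_{(\alpha,u)\wr\wr p}|I(\alpha,u)|$ (with coordinates indexed by the variables $X_i(\alpha,u)$); it does not depend on the choice of $t_1,\dots,t_s$.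 The map $\Phi_p$. For $k=(k_i(\alpha,u))\in V_p$, $\Phi_p(k)$ is (the isomorphism type of) the module $\Lambda e(1)/U_k$, which is uniserial with mast $p$, where $$U_k=\sum_{(\alpha,u)\wr\wr p}\Lambda\Bigl(\alpha u-\sum_{i\in I(\alpha,u)}k_i(\alpha,u)v_i(\alpha,u)\Bigr)+\sum_{q\ \text{a path that is not a route on}\ p}\Lambda q e(1).$$ The system $S_p(X,Y,Z)$. Let $Y$ be a second family of independent variables $Y_i(\alpha,u)$, $(\alpha,u)\wr\wr p$, $i\in I(\alpha,u)$, and work in the polynomial ring $K\Gamma[X,Y,Z]$ with coefficients in $K\Gamma$. For each detour $(\alpha,u)$ on $p$ consider the equation $$\sum_{i\in I(\alpha,u)}X_i(\alpha,u)v_i(\alpha,u)\Bigl(e(1)+\sum_{j=1}^tZ_jw_j\Bigr)=\alpha u\Bigl(e(1)+\sum_{j=1}^tZ_jw_j\Bigr).$$ Expand both sides by successively inserting from the right the substitutions $\beta v\mapsto\sum_{i\in I(\beta,v)}Y_i(\beta,v)v_i(\beta,v)$ for detours $(\beta,v)$ on $p$ and $q\mapsto0$ for paths $q$ that are not routes on $p$ (that is, replace a path $q''\beta v$ by $\sum_iY_i(\beta,v)q''v_i(\beta,v)$, and a path $q''q$ with $q$ a non-route by $0$), until only right subpaths of $p$ remain. Equivalently, reduce both sides modulo the left ideal of $K\Gamma[X,Y,Z]$ generated by the non-routes on $p$ and the elements $\beta v-\sum_iY_i(\beta,v)v_i(\beta,v)$. The two sides then take the form $$\sum_{i\in I(\alpha,u)}a_i(X,Y,Z)v_i(\alpha,u)\quad\text{and}\quad\sum_{i\in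 I(\alpha,u)}b_i(X,Y,Z)v_i(\alpha,u)$$ with uniquely determined polynomials $a_i,b_i\in K[X,Y,Z]$. The system $S_p(X,Y,Z)$ consists of all the equations $a_i(X,Y,Z)=b_i(X,Y,Z)$, $i\in I(\alpha,u)$, arising in this way from all detours $(\alpha,u)$ on $p$. It is linear in the $Z_j$; $S_p(k,k',Z)$ denotes the linear system obtained by substituting $X=k$, $Y=k'$. *)

(* Defs.v *)
From HB Require Import structures.
From mathcomp Require Import all_boot all_order all_algebra finmap boolp.
From mathcomp.multinomials Require Import monalg.
From mathcomp.multinomials Require mpoly.

Set Implicit Arguments.
Unset Strict Implicit.
Unset Printing Implicit Defensive.
Import GRing.Theory Quotient.Exports.
Local Open Scope ring_scope.

(* Subsets that need not be decidable are predicates T -> Prop; they become   *)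
(* boolean, classically, only where a quotient or a subtype is formed.        *)

Section Span.
Variables (R : pzRingType) (V : lmodType R) (S : V -> Prop).

Definition span (v : V) : Prop :=
  exists s : seq (R * V),
    (forall x, x \in s -> S x.2) /\ v = \sum_(x <- s) x.1 *: x.2.

Definition spanp : {pred V} := [pred v | `[< span v >]].

Fact spanp_closed : subsemimod_closed spanp.
Proof.
split; first split.
- by apply/asboolP; exists [::]; split=> //; rewrite big_nil.
- move=> u v /asboolP[s [sS ->]] /asboolP[s' [sS' ->]].
  apply/asboolP; exists (s ++ s'); split; last by rewrite big_cat.
  by move=> x; rewrite mem_cat => /orP[/sS|/sS'].
- move=> a v /asboolP[s [sS ->]]; apply/asboolP.
  exists [seq (a * x.1, x.2) | x <- s]; split.
    by move=> _ /mapP[x xs ->]; apply: sS xs.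
  by rewrite big_map scaler_sumr; apply: eq_bigr => x _; rewrite scalerA.
Qed.

HB.instance Definition _ := GRing.isSubmodClosed.Build R V spanp spanp_closed.

Definition quotmod : Type := Quotient.quot spanp.
HB.instance Definition _ := GRing.Zmodule.on quotmod.

Definition quotmod_scale (a : R) (x : quotmod) : quotmod :=
  \pi_(Quotient.quot spanp)%qT (a *: repr (x : Quotient.quot spanp)).

Fact quotmod_scale_pi a (v : V) :
  quotmod_scale a (\pi_(Quotient.quot spanp)%qT v)
    = \pi_(Quotient.quot spanp)%qT (a *: v).
Proof.
apply/eqP; rewrite /quotmod_scale -Quotient.idealrBE -scalerBr.
by apply: rpredZ; rewrite Quotient.idealrBE reprK.
Qed.

Fact quotmod_scaleA a b (x : quotmod) :
  quotmod_scale a (quotmod_scale b x) = quotmod_scale (a * b) x.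
Proof.
by rewrite -[x](@reprK _ (Quotient.quot spanp)) !quotmod_scale_pi scalerA.
Qed.

Fact quotmod_scale1 : left_id 1 quotmod_scale.
Proof.
move=> x; rewrite -[x](@reprK _ (Quotient.quot spanp)).
by rewrite !quotmod_scale_pi scale1r.
Qed.

Fact quotmod_scaleDr : right_distributive quotmod_scale +%R.
Proof.
move=> a x y; rewrite -[x](@reprK _ (Quotient.quot spanp)).
rewrite -[y](@reprK _ (Quotient.quot spanp)).
by rewrite -raddfD !quotmod_scale_pi scalerDr raddfD.
Qed.

Fact quotmod_scaleDl (x : quotmod) : {morph quotmod_scale^~ x : a b / a + b}.
Proof.
move=> a b; rewrite -[x](@reprK _ (Quotient.quot spanp)).
by rewrite !quotmod_scale_pi scalerDl raddfD.
Qed.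

HB.instance Definition _ := GRing.Zmodule_isLmodule.Build R quotmod
  quotmod_scaleA quotmod_scale1 quotmod_scaleDr quotmod_scaleDl.
End Span.

Definition left_ideal_gen (A : pzRingType) (S : A -> Prop) : A -> Prop :=
  span (S : (A^o : lmodType A) -> Prop).

Record ideal (A : pzRingType) := Ideal {
  ideal_mem :> A -> Prop;
  ideal0 : ideal_mem 0;
  idealB : forall x y, ideal_mem x -> ideal_mem y -> ideal_mem (x - y);
  idealMl : forall a x, ideal_mem x -> ideal_mem (a * x);
  idealMr : forall a x, ideal_mem x -> ideal_mem (x * a) }.

Section QuotientRing.
Variables (A : pzRingType) (I : ideal A).

Definition idealp : {pred A} := [pred x | `[< I x >]].

Fact idealp_closed : zmod_closed idealp.
Proof.
split; first by apply/asboolP; exact: ideal0.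
by move=> x y /asboolP Ix /asboolP Iy; apply/asboolP; exact: idealB.
Qed.

HB.instance Definition _ := GRing.isZmodClosed.Build A idealp idealp_closed.

(* ring_quotient only makes quotients of commutative rings into rings. *)
Definition quotring : Type := Quotient.quot idealp.
HB.instance Definition _ := GRing.Zmodule.on quotring.

Definition quotring_pi (x : A) : quotring := \pi_(Quotient.quot idealp)%qT x.

Definition quotring_mul (x y : quotring) : quotring :=
  quotring_pi (repr (x : Quotient.quot idealp) * repr (y : Quotient.quot idealp)).

Fact quotring_piP x : exists a, x = quotring_pi a.
Proof. by exists (repr (x : Quotient.quot idealp)); rewrite /quotring_pi reprK. Qed.

Fact quotring_piB : {morph quotring_pi : x y / x - y}.
Proof. by move=> x y; rewrite /quotring_pi raddfB. Qed.

Fact quotring_piD : {morph quotring_pi : x y / x + y}.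
Proof. by move=> x y; rewrite /quotring_pi raddfD. Qed.

Fact quotring_pi_eq x y : quotring_pi x = quotring_pi y <-> I (x - y).
Proof.
rewrite /quotring_pi; split=> [/eqP|Ixy]; last apply/eqP.
  by rewrite -Quotient.idealrBE => /asboolP.
by rewrite -Quotient.idealrBE; apply/asboolP.
Qed.

Fact quotring_mul_pi x y :
  quotring_mul (quotring_pi x) (quotring_pi y) = quotring_pi (x * y).
Proof.
rewrite /quotring_mul; set x' := repr _; set y' := repr _.
have Ix : I (x' - x) by apply/quotring_pi_eq; rewrite /x' /quotring_pi reprK.
have Iy : I (y' - y) by apply/quotring_pi_eq; rewrite /y' /quotring_pi reprK.
apply/quotring_pi_eq.
have -> : x' * y' - x * y = (x' - x) * y' - (- x) * (y' - y).
  by rewrite mulNr opprK mulrBl mulrBr addrA subrK.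
by apply: idealB; [exact: idealMr|exact: idealMl].
Qed.

Fact quotring_mulA : associative quotring_mul.
Proof.
move=> x y z; have [a ->] := quotring_piP x; have [b ->] := quotring_piP y.
by have [c ->] := quotring_piP z; rewrite !quotring_mul_pi mulrA.
Qed.

Fact quotring_mul1l : left_id (quotring_pi 1) quotring_mul.
Proof.
by move=> x; have [a ->] := quotring_piP x; rewrite quotring_mul_pi mul1r.
Qed.

Fact quotring_mul1r : right_id (quotring_pi 1) quotring_mul.
Proof.
by move=> x; have [a ->] := quotring_piP x; rewrite quotring_mul_pi mulr1.
Qed.

Fact quotring_mulDl : left_distributive quotring_mul +%R.
Proof.
move=> x y z; have [a ->] := quotring_piP x; have [b ->] := quotring_piP y.
have [c ->] := quotring_piP z.
by rewrite -quotring_piD !quotring_mul_pi -quotring_piD mulrDl.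
Qed.

Fact quotring_mulDr : right_distributive quotring_mul +%R.
Proof.
move=> x y z; have [a ->] := quotring_piP x; have [b ->] := quotring_piP y.
have [c ->] := quotring_piP z.
by rewrite -quotring_piD !quotring_mul_pi -quotring_piD mulrDr.
Qed.

HB.instance Definition _ := GRing.Zmodule_isPzRing.Build quotring
  quotring_mulA quotring_mul1l quotring_mul1r quotring_mulDl quotring_mulDr.
End QuotientRing.

Section PrincipalLeftIdeal.
Variables (A : pzRingType) (e : A).

Definition lprincp : {pred A^o} := [pred x | `[< exists y : A, x = y * e >]].

Fact lprincp_closed : subsemimod_closed lprincp.
Proof.
split; first split.
- by apply/asboolP; exists 0; rewrite mul0r.
- move=> x y /asboolP[a ->] /asboolP[b ->]; apply/asboolP.
  by exists (a + b); rewrite mulrDl.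
- move=> a x /asboolP[b ->]; apply/asboolP; exists (a * b).
  by rewrite -mulrA.
Qed.

HB.instance Definition _ :=
  GRing.isSubmodClosed.Build A A^o lprincp lprincp_closed.

Record lprinc := LPrinc { lprinc_val : A^o; _ : lprincp lprinc_val }.
HB.instance Definition _ := [isSub for lprinc_val].
HB.instance Definition _ := [Choice of lprinc by <:].
HB.instance Definition _ := [SubChoice_isSubLmodule of lprinc by <:].

Fact lprinc_mul_subproof (x : A) : lprincp (x * e : A^o).
Proof. by apply/asboolP; exists x. Qed.

Definition lprinc_mul (x : A) : lprinc := LPrinc (lprinc_mul_subproof x).
End PrincipalLeftIdeal.

Section Radical.
Variable A : pzRingType.

Definition left_ideal (M : A -> Prop) : Prop :=
  [/\ M 0, forall x y, M x -> M y -> M (x + y) & forall a x, M x -> M (a * x)].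

Definition maximal_left_ideal (M : A -> Prop) : Prop :=
  [/\ left_ideal M, ~ M 1 &
      forall N : A -> Prop, left_ideal N -> (forall x, M x -> N x) -> ~ N 1 ->
        forall x, N x -> M x].

Definition jacobson (x : A) : Prop := forall M, maximal_left_ideal M -> M x.

Definition ideal_prod (M N : A -> Prop) (x : A) : Prop :=
  exists s : seq (A * A),
    (forall y, y \in s -> M y.1 /\ N y.2) /\ x = \sum_(y <- s) y.1 * y.2.

Fixpoint ideal_pow (M : A -> Prop) (n : nat) : A -> Prop :=
  if n is n'.+1 then ideal_prod M (ideal_pow M n') else fun=> True.

Definition loewy_length (L : nat) : Prop :=
  (forall x, ideal_pow jacobson L x -> x = 0) /\
  (forall m, (forall x, ideal_pow jacobson m x -> x = 0) -> (L <= m)%N).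
End Radical.

Record quiver := Quiver {
  vertex : finType;
  arrow : finType;
  src : arrow -> vertex;
  tgt : arrow -> vertex }.

Section Paths.
Variable G : quiver.

Fixpoint walk (x : vertex G) (s : seq (arrow G)) : bool :=
  if s is a :: s' then (src a == x) && walk (tgt a) s' else true.

(* A path is a starting vertex with the list of its arrows in the order in    *)
(* which they are traversed; thus right subpaths are initial segments.        *)
Record qpath := QPath {
  qpath_val : vertex G * seq (arrow G);
  _ : walk qpath_val.1 qpath_val.2 }.
HB.instance Definition _ := [isSub for qpath_val].
HB.instance Definition _ := [Choice of qpath by <:].

Definition pbeg (p : qpath) : vertex G := (qpath_val p).1.
Definition parr (p : qpath) : seq (arrow G) := (qpath_val p).2.
Definition plen (p : qpath) : nat := size (parr p).
Definition pvertices (p : qpath) : seq (vertex G) :=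
  pbeg p :: [seq tgt a | a <- parr p].
Definition pend (p : qpath) : vertex G :=
  last (pbeg p) [seq tgt a | a <- parr p].

Definition pid (x : vertex G) : qpath := @QPath (x, [::]) isT.

Fact parrow_subproof (a : arrow G) : walk (src a) [:: a].
Proof. by rewrite /= eqxx. Qed.
Definition parrow (a : arrow G) : qpath :=
  @QPath (src a, [:: a]) (parrow_subproof a).

Fact walk_cat x s s' :
  walk x (s ++ s') = walk x s && walk (last x [seq tgt a | a <- s]) s'.
Proof. by elim: s x => //= a s IHs x; rewrite IHs andbA. Qed.

(* The product qp (q after p); None encodes the product 0. *)
Definition pcomp (q p : qpath) : option qpath :=
  if pend p == pbeg q then insub (pbeg p, parr p ++ parr q) else None.

Fact pcomp_spec q p r : pcomp q p = Some r <->
  pend p = pbeg q /\ qpath_val r = (pbeg p, parr p ++ parr q).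
Proof.
rewrite /pcomp; split.
  by case: eqP => // epq; case: insubP => // r' _ er' [<-].
move=> [-> er]; rewrite eqxx -er; exact: valK.
Qed.

Fact pcomp_some q p : pend p = pbeg q -> {r | pcomp q p = Some r}.
Proof.
move=> epq; rewrite /pcomp epq eqxx; case: insubP => [r _ _|]; first by exists r.
move: epq; case: q p => [[xq sq] /= wq] [[xp sp] /= wp].
by rewrite /pend /pbeg /parr /= walk_cat wp => -> /=; rewrite wq.
Qed.

Fact pcomp_none q p : pend p != pbeg q -> pcomp q p = None.
Proof. by rewrite /pcomp => /negPf->. Qed.

Fact pend_pcomp q p r : pcomp q p = Some r -> pend r = pend q.
Proof.
case/pcomp_spec => epq er.
by rewrite {1}/pend {1}/pbeg {1}/parr er /= map_cat last_cat -/(pend p) epq.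
Qed.

Fact pbeg_pcomp q p r : pcomp q p = Some r -> pbeg r = pbeg p.
Proof. by case/pcomp_spec => _ er; rewrite {1}/pbeg er. Qed.

Fact pcompA r q p : obind (pcomp r) (pcomp q p) = obind (pcomp^~ p) (pcomp r q).
Proof.
have [e1|n1] := eqVneq (pend p) (pbeg q); have [e2|n2] := eqVneq (pend q) (pbeg r).
- have [s Es] := pcomp_some e1; have [t Et] := pcomp_some e2; rewrite Es Et /=.
  have es: pend s = pbeg r by rewrite (pend_pcomp Es).
  have et: pend p = pbeg t by rewrite (pbeg_pcomp Et).
  have [x Ex] := pcomp_some es; have [y Ey] := pcomp_some et; rewrite Ex Ey.
  congr Some; apply: val_inj => /=.
  case/pcomp_spec: Ex => _ ->; case/pcomp_spec: Ey => _ ->.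
  by rewrite /pbeg /parr; case/pcomp_spec: Es => _ ->; case/pcomp_spec: Et => _ -> /=;
     rewrite catA.
- have [s Es] := pcomp_some e1; rewrite Es (pcomp_none n2) /= pcomp_none //.
  by rewrite (pend_pcomp Es).
- have [t Et] := pcomp_some e2; rewrite Et (pcomp_none n1) /= pcomp_none //.
  by rewrite (pbeg_pcomp Et).
- by rewrite (pcomp_none n1) (pcomp_none n2).
Qed.

Fact qpath_eta p : (pbeg p, parr p) = val p.
Proof. by rewrite /pbeg /parr -surjective_pairing. Qed.

Fact pcomp_pidl p x : pcomp (pid x) p = if pend p == x then Some p else None.
Proof.
rewrite /pcomp {1}/pbeg /=; case: eqP => // _.
by rewrite cats0 qpath_eta valK.
Qed.

Fact pcomp_pidr p x : pcomp p (pid x) = if pbeg p == x then Some p else None.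
Proof.
rewrite /pcomp {1}/pend /= eq_sym; case: eqP => // <-.
by rewrite qpath_eta valK.
Qed.

Definition rsubs (p : qpath) : seq qpath :=
  pmap insub [seq (pbeg p, take m (parr p)) | m <- iota 0 (plen p).+1].

Fact rsubsP v p : v \in rsubs p <-> exists w, pcomp w v = Some p.
Proof.
rewrite mem_pmap_sub; split=> [/mapP[m]|[w /pcomp_spec[ew ep]]].
  move=> _ ev; set d := drop m (parr p).
  have wp : walk (pbeg p) (take m (parr p) ++ d).
    by rewrite cat_take_drop; exact: (valP p).
  have [ebv eav] : pbeg v = pbeg p /\ parr v = take m (parr p).
    by rewrite {1}/pbeg {1}/parr; split; rewrite [qpath_val v]ev.
  have wd : walk (pend v) d.
    by move: wp; rewrite walk_cat /pend ebv eav => /andP[].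
  exists (@QPath (pend v, d) wd); apply/pcomp_spec; split=> //.
  by rewrite ebv eav {2}/parr /= cat_take_drop -[LHS]qpath_eta.
have [ebp eap] : pbeg p = pbeg v /\ parr p = parr v ++ parr w.
  by rewrite {1}/pbeg {1}/parr ep.
apply/mapP; exists (plen v).
  by rewrite mem_iota /= add0n ltnS /plen eap size_cat leq_addr.
by rewrite ebp eap take_size_cat // qpath_eta.
Qed.
End Paths.

(* The path algebra of G over R is free over R on the paths.  Its operations  *)
(* are locked, as unification otherwise unfolds them down to finite maps.     *)
Record pathAlg (R : comNzRingType) (G : quiver) :=
  PathAlg { pa_val : {malg R[qpath G]} }.

HB.instance Definition _ (R : comNzRingType) (G : quiver) :=
  [isNew for @pa_val R G].
HB.instance Definition _ (R : comNzRingType) (G : quiver) :=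
  [Choice of pathAlg R G by <:].

HB.lock Definition pa_zero (R : comNzRingType) (G : quiver) : pathAlg R G :=
  PathAlg 0.
HB.lock Definition pa_opp (R : comNzRingType) (G : quiver) (f : pathAlg R G) :
  pathAlg R G := PathAlg (- pa_val f).
HB.lock Definition pa_add (R : comNzRingType) (G : quiver) (f g : pathAlg R G) :
  pathAlg R G := PathAlg (pa_val f + pa_val g).
HB.lock Definition pa_scale (R : comNzRingType) (G : quiver) (a : R)
  (f : pathAlg R G) : pathAlg R G := PathAlg (a *: pa_val f).

HB.lock Definition pelt (R : comNzRingType) (G : quiver) (p : qpath G) :
  pathAlg R G := PathAlg << p >>.
Arguments pelt {R G} p.

Definition pcoef (R : comNzRingType) (G : quiver) (f : pathAlg R G)
  (q : qpath G) : R := (pa_val f)@_q.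
Definition psupp (R : comNzRingType) (G : quiver) (f : pathAlg R G) :
  {fset qpath G} := msupp (pa_val f).

Section PathModule.
Variables (R : comNzRingType) (G : quiver).
Local Notation A := (pathAlg R G).
Implicit Types (f g h : A) (p q : qpath G).

Fact pa_addA : associative (@pa_add R G).
Proof. by move=> f g h; apply: val_inj; rewrite !pa_add.unlock /= addrA. Qed.
Fact pa_addC : commutative (@pa_add R G).
Proof. by move=> f g; apply: val_inj; rewrite !pa_add.unlock /= addrC. Qed.
Fact pa_add0 : left_id (pa_zero R G) (@pa_add R G).
Proof.
by move=> f; apply: val_inj; rewrite pa_add.unlock pa_zero.unlock /= add0r.
Qed.
Fact pa_addN : left_inverse (pa_zero R G) (@pa_opp R G) (@pa_add R G).
Proof.
move=> f; apply: val_inj.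
by rewrite pa_add.unlock pa_zero.unlock pa_opp.unlock /= addNr.
Qed.

HB.instance Definition _ := GRing.isZmodule.Build A
  pa_addA pa_addC pa_add0 pa_addN.

Fact pa_val0 : pa_val (0 : A) = 0.
Proof. by rewrite /GRing.zero /= pa_zero.unlock. Qed.
Fact pa_valD f g : pa_val (f + g) = pa_val f + pa_val g.
Proof. by rewrite {1}/GRing.add /= pa_add.unlock. Qed.

Fact pa_scaleA a b f : pa_scale a (pa_scale b f) = pa_scale (a * b) f.
Proof. by apply: val_inj; rewrite !pa_scale.unlock /= scalerA. Qed.
Fact pa_scale1 : left_id 1 (@pa_scale R G).
Proof. by move=> f; apply: val_inj; rewrite pa_scale.unlock /= scale1r. Qed.
Fact pa_scaleDr : right_distributive (@pa_scale R G) +%R.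
Proof.
move=> a f g; apply: val_inj => /=; rewrite pa_valD.
by rewrite !pa_scale.unlock /= pa_valD scalerDr.
Qed.
Fact pa_scaleDl f : {morph (@pa_scale R G)^~ f : a b / a + b}.
Proof.
move=> a b; apply: val_inj => /=; rewrite pa_valD.
by rewrite !pa_scale.unlock /= scalerDl.
Qed.

HB.instance Definition _ := GRing.Zmodule_isLmodule.Build R A
  pa_scaleA pa_scale1 pa_scaleDr pa_scaleDl.

Fact pa_valZ a f : pa_val (a *: f) = a *: pa_val f.
Proof. by rewrite {1}/GRing.scale /= pa_scale.unlock. Qed.

Fact pathAlgP f g : (forall q, pcoef f q = pcoef g q) <-> f = g.
Proof. by split=> [fg|-> //]; apply: val_inj; apply/malgP. Qed.
Fact pcoef0 q : pcoef (0 : A) q = 0.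
Proof. by rewrite /pcoef pa_val0 mcoeff0. Qed.
Fact pcoefD f g q : pcoef (f + g) q = pcoef f q + pcoef g q.
Proof. by rewrite /pcoef pa_valD mcoeffD. Qed.
Fact pcoefZ a f q : pcoef (a *: f) q = a * pcoef f q.
Proof. by rewrite /pcoef pa_valZ mcoeffZ. Qed.
Fact pcoef_sum (T : Type) (s : seq T) (P : pred T) (F : T -> A) q :
  pcoef (\sum_(i <- s | P i) F i) q = \sum_(i <- s | P i) pcoef (F i) q.
Proof.
exact: (big_morph (fun f => pcoef f q) (fun _ _ => pcoefD _ _ _) (pcoef0 q)).
Qed.
Fact pcoef_pelt p q : pcoef (pelt p) q = (p == q)%:R :> R.
Proof. by rewrite /pcoef pelt.unlock /= (mcoeffU p 1 q). Qed.

Fact pcoef_outdom f q : q \notin psupp f -> pcoef f q = 0.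
Proof. exact: mcoeff_outdom. Qed.
Fact psuppD_le f g : (psupp (f + g)%R `<=` psupp f `|` psupp g)%fset.
Proof. by rewrite /psupp pa_valD msuppD_le. Qed.
Fact psuppZ_le a f : (psupp (a *: f)%R `<=` psupp f)%fset.
Proof. by rewrite /psupp pa_valZ msuppZ_le. Qed.
Fact psupp_pelt p : psupp (pelt p : A) = [fset p]%fset.
Proof. by rewrite /psupp pelt.unlock /= msuppU oner_eq0. Qed.

Fact pathAlgE f : f = \sum_(p <- psupp f) pcoef f p *: pelt p.
Proof.
apply/pathAlgP => q; rewrite pcoef_sum.
rewrite {1}/pcoef {1}[pa_val f]monalgE raddf_sum /=; apply: eq_bigr => p _.
by rewrite (mcoeffU p _ q) pcoefZ pcoef_pelt mulr_natr.
Qed.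

Fact pathAlg_ind (P : A -> Prop) :
  P 0 -> (forall f g, P f -> P g -> P (f + g)) ->
  (forall a p, P (a *: pelt p)) -> forall f, P f.
Proof.
by move=> P0 PD PZ f; rewrite [f]pathAlgE; elim/big_ind: _ => // p _.
Qed.
End PathModule.

HB.lock Definition pa_mul (R : comNzRingType) (G : quiver) (f g : pathAlg R G) :
    pathAlg R G :=
  \sum_(q <- psupp f) \sum_(p <- psupp g)
    (pcoef f q * pcoef g p) *: oapp pelt 0 (pcomp q p).

HB.lock Definition pa_one (R : comNzRingType) (G : quiver) : pathAlg R G :=
  \sum_(x : vertex G) pelt (pid x).

Section PathAlgebra.
Variables (R : comNzRingType) (G : quiver).
Local Notation A := (pathAlg R G).
Local Notation pa_mul := (@pa_mul R G).
Local Notation pa_one := (@pa_one R G).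
Local Notation pelt := (@pelt R G).
Implicit Types (f g h : A) (p q r : qpath G).

Definition pelt_mul q p : A := oapp pelt 0 (pcomp q p).

Fact pa_mulw (d1 d2 : {fset qpath G}) f g :
  (psupp f `<=` d1)%fset -> (psupp g `<=` d2)%fset ->
  pa_mul f g =
    \sum_(q <- d1) \sum_(p <- d2) (pcoef f q * pcoef g p) *: pelt_mul q p.
Proof.
move=> le1 le2; rewrite pa_mul.unlock (big_fset_incl _ le1) /=; last first.
  move=> q _ /pcoef_outdom fq; rewrite big1 // => p _.
  by rewrite fq mul0r scale0r.
apply: eq_bigr => q _; apply: big_fset_incl => // p _ /pcoef_outdom gp.
by rewrite gp mulr0 scale0r.
Qed.

Fact pa_mulDl : left_distributive pa_mul +%R.
Proof.
move=> f g h; set d := (psupp f `|` psupp g)%fset.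
rewrite (@pa_mulw d (psupp h)) ?psuppD_le //.
rewrite (@pa_mulw d (psupp h) f) ?fsubsetUl // (@pa_mulw d (psupp h) g) ?fsubsetUr //.
rewrite -big_split; apply: eq_bigr => q _ /=; rewrite -big_split.
by apply: eq_bigr => p _ /=; rewrite pcoefD mulrDl scalerDl.
Qed.

Fact pa_mulDr : right_distributive pa_mul +%R.
Proof.
move=> h f g; set d := (psupp f `|` psupp g)%fset.
rewrite (@pa_mulw (psupp h) d) ?psuppD_le //.
rewrite (@pa_mulw (psupp h) d _ f) ?fsubsetUl // (@pa_mulw (psupp h) d _ g) ?fsubsetUr //.
rewrite -big_split; apply: eq_bigr => q _ /=; rewrite -big_split.
by apply: eq_bigr => p _ /=; rewrite pcoefD mulrDr scalerDl.
Qed.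

Fact pa_mul0l f : pa_mul 0 f = 0.
Proof. by apply: (addIr (pa_mul 0 f)); rewrite -pa_mulDl !add0r. Qed.

Fact pa_mul0r f : pa_mul f 0 = 0.
Proof. by apply: (addIr (pa_mul f 0)); rewrite -pa_mulDr !add0r. Qed.

Fact pa_mulZZ a b f g : pa_mul (a *: f) (b *: g) = (a * b) *: pa_mul f g.
Proof.
rewrite (@pa_mulw (psupp f) (psupp g)) ?psuppZ_le //.
rewrite [in RHS]pa_mul.unlock scaler_sumr.
apply: eq_bigr => q _; rewrite scaler_sumr; apply: eq_bigr => p _.
by rewrite !pcoefZ scalerA mulrACA.
Qed.

Fact pa_mulZl a f g : pa_mul (a *: f) g = a *: pa_mul f g.
Proof. by rewrite -{1}[g]scale1r pa_mulZZ mulr1. Qed.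

Fact pa_mulZr a f g : pa_mul f (a *: g) = a *: pa_mul f g.
Proof. by rewrite -{1}[f]scale1r pa_mulZZ mul1r. Qed.

Fact pa_mul_pelt q p : pa_mul (pelt q) (pelt p) = pelt_mul q p.
Proof.
rewrite (@pa_mulw [fset q]%fset [fset p]%fset) ?psupp_pelt //.
by rewrite !big_seq_fset1 !pcoef_pelt !eqxx mulr1 scale1r.
Qed.

Fact pa_mul_suml (T : Type) (s : seq T) (P : pred T) (F : T -> A) g :
  pa_mul (\sum_(i <- s | P i) F i) g = \sum_(i <- s | P i) pa_mul (F i) g.
Proof.
exact: (big_morph (fun f => pa_mul f g) (fun _ _ => pa_mulDl _ _ _) (pa_mul0l g)).
Qed.

Fact pa_mul_sumr (T : Type) (s : seq T) (P : pred T) (F : T -> A) g :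
  pa_mul g (\sum_(i <- s | P i) F i) = \sum_(i <- s | P i) pa_mul g (F i).
Proof.
exact: (big_morph (fun f => pa_mul g f) (fun _ _ => pa_mulDr _ _ _) (pa_mul0r g)).
Qed.

Fact pa_mulA : associative pa_mul.
Proof.
move=> f g h; elim/pathAlg_ind: f => [|f1 f2 IH1 IH2|a r].
- by rewrite !pa_mul0l.
- by rewrite !pa_mulDl IH1 IH2.
elim/pathAlg_ind: g => [|g1 g2 IH1 IH2|b q].
- by rewrite pa_mul0l pa_mul0r pa_mul0l.
- by rewrite !(pa_mulDl, pa_mulDr) IH1 IH2.
elim/pathAlg_ind: h => [|h1 h2 IH1 IH2|c p].
- by rewrite !pa_mul0r.
- by rewrite !pa_mulDr IH1 IH2.
rewrite !pa_mulZZ mulrA !pa_mul_pelt; congr (_ *: _).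
have := pcompA r q p; rewrite /pelt_mul.
case: (pcomp q p) => [s|]; case: (pcomp r q) => [t|] /= E.
- by rewrite !pa_mul_pelt /pelt_mul E.
- by rewrite pa_mul0l pa_mul_pelt /pelt_mul E.
- by rewrite pa_mul0r pa_mul_pelt /pelt_mul -E.
- by rewrite pa_mul0r pa_mul0l.
Qed.

Fact pa_mul1l : left_id pa_one pa_mul.
Proof.
elim/pathAlg_ind => [|f g IHf IHg|a p]; rewrite ?pa_mul0r ?pa_mulDr ?IHf ?IHg //.
rewrite pa_mulZr pa_one.unlock pa_mul_suml (bigD1 (pend p)) //= pa_mul_pelt big1.
  by rewrite addr0 /pelt_mul pcomp_pidl eqxx.
move=> x nx; rewrite pa_mul_pelt /pelt_mul pcomp_pidl.
by rewrite eq_sym (negPf nx).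
Qed.

Fact pa_mul1r : right_id pa_one pa_mul.
Proof.
elim/pathAlg_ind => [|f g IHf IHg|a p]; rewrite ?pa_mul0l ?pa_mulDl ?IHf ?IHg //.
rewrite pa_mulZl pa_one.unlock pa_mul_sumr (bigD1 (pbeg p)) //= pa_mul_pelt big1.
  by rewrite addr0 /pelt_mul pcomp_pidr eqxx.
move=> x nx; rewrite pa_mul_pelt /pelt_mul pcomp_pidr.
by rewrite eq_sym (negPf nx).
Qed.

HB.instance Definition _ := GRing.Zmodule_isPzRing.Build A
  pa_mulA pa_mul1l pa_mul1r pa_mulDl pa_mulDr.
End PathAlgebra.

Definition pa_map (R S : comNzRingType) (G : quiver) (f : R -> S)
    (z : pathAlg R G) : pathAlg S G :=
  \sum_(q <- psupp z) f (pcoef z q) *: pelt q.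

(* All relations lie in the span of the paths of length at least 2, and all   *)
(* sufficiently long paths are relations.                                     *)
Definition admissible (K : fieldType) (G : quiver) (I : ideal (pathAlg K G)) :
    Prop :=
  (forall z, I z -> forall q, q \in psupp z -> (2 <= plen q)%N) /\
  (exists m : nat, forall q : qpath G, (m <= plen q)%N -> I (pelt q)).

Definition spans_upto (K : fieldType) (G : quiver) (I : ideal (pathAlg K G))
    (L s : nat) (t : 'I_s -> pathAlg K G) : Prop :=
  let IL z := I z /\ forall q, q \in psupp z -> (plen q <= L)%N in
  (forall j, IL (t j)) /\
  (forall z, IL z -> exists c : 'I_s -> K, z = \sum_j c j *: t j).

(* Imported only here: its notations clash with those of monalg. *)
Import mpoly.

Definition polyring (K : fieldType) (V : finType) : comNzRingType :=
  {mpoly K[#|V|]}.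
Definition pvar (K : fieldType) (V : finType) (v : V) : polyring K V :=
  'X_(enum_rank v).
Definition pconst (K : fieldType) (V : finType) (c : K) : polyring K V := c%:MP.
Definition peval (K : fieldType) (V : finType) (k : V -> K)
    (P : polyring K V) : K := meval (fun i => k (enum_val i)) P.

Section Detours.
Variables (G : quiver) (p : qpath G).

Definition rsub : finType := seq_sub (rsubs p).

Definition detour (a : arrow G) (u : qpath G) : bool :=
  [&& u \in rsubs p,
      pcomp (parrow a) u != None,
      pcomp (parrow a) u \notin [seq Some v | v <- rsubs p] &
      has (fun v => (plen u + 1 <= plen v)%N && (pend v == tgt a)) (rsubs p)].

Definition detours : finType :=
  {d : arrow G * rsub | detour d.1 (ssval d.2)}.
Definition darrow (d : detours) : arrow G := (val d).1.
Definition dpath (d : detours) : qpath G := ssval (val d).2.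

(* I(alpha,u); the right subpath v_i(alpha,u) serves as its own index i. *)
Definition Idx (d : detours) : finType :=
  {v : rsub | (plen (dpath d) < plen (ssval v))%N
              && (pend (ssval v) == tgt (darrow d))}.
Definition vpath (d : detours) (i : Idx d) : qpath G := ssval (val i).

(* X_i(alpha,u) is the variable indexed by Tagged Idx i, for i : Idx d with d *)
(* the detour (alpha,u); points of affine N-space are functions Xidx -> K.    *)
Definition Xidx : finType := {d : detours & Idx d}.

Definition route (q : qpath G) : bool :=
  (pbeg q == pbeg p) && subseq (pvertices q) (pvertices p).

Section Relations.
Variables (R : comNzRingType) (c : Xidx -> R).

Definition drel (d : detours) : pathAlg R G :=
  pelt (parrow (darrow d)) * pelt (dpath d)
  - \sum_(i : Idx d) c (Tagged Idx i) *: pelt (vpath i).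

Definition subst_ideal : pathAlg R G -> Prop :=
  left_ideal_gen (fun x : pathAlg R G =>
    (exists2 q, ~~ route q & x = pelt q) \/ (exists d, x = drel d)).
End Relations.

(* The w_j serve as the indices j of the unknowns Z_j. *)
Definition Zidx : finType :=
  {w : rsub | (0 < plen (ssval w))%N && (pend (ssval w) == pbeg p)}.
Definition wpath (j : Zidx) : qpath G := ssval (val j).
End Detours.

(* The polynomial ring KG[X] is taken in the form of the path algebra of G    *)
(* with coefficients in K[X].                                                 *)
Section Variety.
Variables (K : fieldType) (G : quiver) (p : qpath G).
Local Notation KX := (polyring K (Xidx p)).

Definition Lideal : pathAlg KX G -> Prop :=
  subst_ideal (fun x : Xidx p => pvar K x).

(* tau is the family of polynomials tau_p'(X) belonging to z; it exists and is *)
(* unique, so that quantifying over all such families in Vp is harmless.      *)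
Definition tau_of (z : pathAlg K G) (tau : rsub p -> KX) : Prop :=
  Lideal (pa_map (@pconst K (Xidx p)) z
          - \sum_(v : rsub p) tau v *: pelt (ssval v)).

Definition Vp (s : nat) (t : 'I_s -> pathAlg K G) (k : Xidx p -> K) : Prop :=
  forall (j : 'I_s) (tau : rsub p -> KX), tau_of (t j) tau ->
    forall v : rsub p, peval k (tau v) = 0.
End Variety.

Section Phi.
Variables (K : fieldType) (G : quiver) (I : ideal (pathAlg K G)).
Variables (p : qpath G) (k : Xidx p -> K).
Local Notation Lam := (quotring I).
Local Notation e1 := (quotring_pi I (pelt (pid (pbeg p)))).

(* Generators of U_k; on drel the multiplication by e(1) is the identity, as  *)
(* all paths occurring there start in e(1).                                   *)
Definition Ugen (x : lprinc e1) : Prop :=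
  (exists d, x = lprinc_mul e1 (quotring_pi I (drel k d))) \/
  (exists2 q, ~~ route p q & x = lprinc_mul e1 (quotring_pi I (pelt q))).

Definition Phi : lmodType Lam := quotmod Ugen.
End Phi.

Definition mod_iso (A : pzRingType) (M N : lmodType A) : Prop :=
  exists f : {linear M -> N}, bijective f.

Section System.
Variables (K : fieldType) (G : quiver) (p : qpath G).

Definition XYZ : finType := (Xidx p + Xidx p + Zidx p)%type.
Local Notation KXYZ := (polyring K XYZ).
Local Notation A := (pathAlg KXYZ G).

Definition Xvar (x : Xidx p) : KXYZ := pvar K (inl (inl x)).
Definition Yvar (y : Xidx p) : KXYZ := pvar K (inl (inr y)).
Definition Zvar (z : Zidx p) : KXYZ := pvar K (inr z).

Definition top_gen : A :=
  pelt (pid (pbeg p)) + \sum_(j : Zidx p) Zvar j *: pelt (wpath j).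

Definition sys_lhs (d : detours p) : A :=
  (\sum_(i : Idx d) Xvar (Tagged (@Idx _ p) i) *: pelt (vpath i)) * top_gen.

Definition sys_rhs (d : detours p) : A :=
  pelt (parrow (darrow d)) * pelt (dpath d) * top_gen.

(* The result of the successive Y-substitutions, given by the reduction modulo *)
(* the left ideal of KG[X,Y,Z].                                               *)
Definition expands_to (d : detours p) (z : A) (a : Idx d -> KXYZ) : Prop :=
  subst_ideal Yvar (z - \sum_(i : Idx d) a i *: pelt (vpath i)).

(* S_p(X,Y,Z); the pair (a, b) stands for the equation a = b. *)
Definition Sp (ab : KXYZ * KXYZ) : Prop :=
  exists (d : detours p) (a b : Idx d -> KXYZ),
    [/\ expands_to (sys_lhs d) a, expands_to (sys_rhs d) b &
        exists i, ab = (a i, b i)].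

Definition point (k k' : Xidx p -> K) (z : Zidx p -> K) (v : XYZ) : K :=
  match v with
  | inl (inl x) => k x
  | inl (inr y) => k' y
  | inr j => z j
  end.

Definition Sp_consistent (k k' : Xidx p -> K) : Prop :=
  exists z : Zidx p -> K, forall ab, Sp ab ->
    peval (point k k' z) ab.1 = peval (point k k' z) ab.2.
End System.

(* Main.v *)
From HB Require Import structures.
From mathcomp Require Import all_boot all_order all_algebra finmap boolp.
From mathcomp.multinomials Require monalg mpoly.
Require Import Defs.

Set Implicit Arguments.
Unset Strict Implicit.
Unset Printing Implicit Defensive.
Import GRing.Theory Quotient.Exports.
Local Open Scope ring_scope.

(** Let e1 be the starting vertex of [p] and L(k) the left ideal
    [subst_ideal k] of the path algebra.  The module [Phi I k] is generated by
    the class of e1.  If [k] lies on the variety, then the annihilator of this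
    class in the path algebra is exactly L(k) ([phi_elt_eq0]), because L(k)
    already contains all relations in [I] ([nf_ideal]): paths of length at
    least the Loewy length L lie in [I], since arrows lie in the radical; those
    of length L and the relations among paths of length at most L are killed by
    the equations of the variety; a longer path is a left multiple of a path of
    length L.

    Hence a homomorphism from [Phi I k] to [Phi I k'] amounts to an element y
    with L(k) y contained in L(k'), and it is an isomorphism when the inclusion
    is sharp and y generates modulo L(k') ([mod_iso_phiP]).

    All computations modulo L(k) are done with a normal form [nf k].  Each path
    is rewritten from the right, and each extension of a right subpath by one
    arrow is a right subpath, a detour, or no route, so that there is nothing
    to choose.  The normal form is a combination of right subpaths of [p]; its
    kernel is L(k) ([subst_idealP]), and it commutes with base change
    ([pa_map_nf]), so that the polynomials of the system, evaluated at a point,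
    are normal form coefficients over the field ([Sp_consistentP]).  The key
    property is [nf_path_in]: rewriting keeps the endpoint, does not shorten
    paths, and only produces paths that pass through the vertices of the
    original path.

    Given an isomorphism, y may be taken in normal form and ending in e1, that
    is, as y0 e1 + sum_j y_j w_j.  Surjectivity forces y0 to be nonzero, because
    rewriting does not shorten paths; so z_j = y_j / y0 solves the system, whose
    equations say that the detour relations with coefficients [k] multiply
    e1 + sum_j z_j w_j into L(k').  Conversely, let z be a solution and
    y = e1 + sum_j z_j w_j.  The non-routes also multiply y into L(k'), whence a
    homomorphism.  It is bijective because y is e1 plus a combination of longer
    paths, so that right multiplication by y is unitriangular with respect to
    length ([left_inverse_unipotent], [unipotent_inj]). *)

(** * Paths and right subpaths *)

Section Combinatorics.
Variable G : quiver.
Implicit Types (p q r u v w : qpath G) (a : arrow G).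

Lemma qpath_eqP q r : pbeg q = pbeg r -> parr q = parr r -> q = r.
Proof. by move=> eb ea; apply: val_inj; rewrite -!qpath_eta eb ea. Qed.

(** Induction on the last arrow, which is the leftmost factor: rewriting goes
    from the right, so that this is the order in which a path is consumed. *)
Lemma qpath_arrow_ind (P : qpath G -> Prop) :
  (forall x, P (pid x)) ->
  (forall a q r, pcomp (parrow a) q = Some r -> P q -> P r) ->
  forall q, P q.
Proof.
move=> Pid Pa q; have [n] := ubnP (plen q).
elim: n q => // n IHn q; rewrite ltnS.
case/lastP Es: (parr q) => [|s a] le_q.
  by rewrite (_ : q = pid (pbeg q)) //; exact: qpath_eqP.
have: walk (pbeg q) (rcons s a) by rewrite -Es; exact: (valP q).
rewrite -cats1 walk_cat => /andP[ws /= /andP[/eqP ea _]].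
pose q' := @QPath G (pbeg q, s) ws.
apply: (Pa a q').
  apply/pcomp_spec; split=> //; rewrite -qpath_eta Es -cats1 //.
by apply: IHn; move: le_q; rewrite /plen Es size_rcons.
Qed.

Lemma plen_pcomp q p r : pcomp q p = Some r -> plen r = (plen p + plen q)%N.
Proof. by case/pcomp_spec => _ er; rewrite /plen {1}/parr er size_cat. Qed.

Lemma pvertices_pcomp q p r : pcomp q p = Some r ->
  pvertices r = pvertices p ++ behead (pvertices q).
Proof.
by case/pcomp_spec => _ er; rewrite /pvertices {1}/parr {1}/pbeg er /= map_cat.
Qed.

Lemma pvertices_arrow a q r : pcomp (parrow a) q = Some r ->
  pvertices r = rcons (pvertices q) (tgt a).
Proof. by move/pvertices_pcomp ->; rewrite cats1. Qed.

(** The endpoint of [p] is the starting vertex of [q], so the vertices of the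
    left factor form a final segment of those of the product. *)
Lemma subseq_pvertices_pcomp q p r : pcomp q p = Some r ->
  subseq (pvertices q) (pvertices r).
Proof.
move=> Er; rewrite (pvertices_pcomp Er); case/pcomp_spec: Er => epq _.
rewrite {2}/pvertices lastI -/(pend p) epq cat_rcons.
exact: suffix_subseq.
Qed.

Lemma pend_arrow a q r : pcomp (parrow a) q = Some r -> pend r = tgt a.
Proof. by move/pend_pcomp. Qed.

Lemma pcomp_arrow_inj a a' q q' r :
  pcomp (parrow a) q = Some r -> pcomp (parrow a') q' = Some r ->
  a = a' /\ q = q'.
Proof.
move=> /pcomp_spec[_ er] /pcomp_spec[_]; rewrite er => -[eb ea].
have := ea; rewrite /= !cats1 => /rcons_inj[es ->]; split=> //.
exact: qpath_eqP.
Qed.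

Section RightSubpaths.
Variable p : qpath G.

Lemma rsubs_pcompr q u r : pcomp q u = Some r -> r \in rsubs p -> u \in rsubs p.
Proof.
move=> Er /rsubsP[w Ew]; apply/rsubsP.
by have := pcompA w q u; rewrite Er /= Ew; case: (pcomp w q) => // x; exists x.
Qed.

Lemma rsubs_pid : pid (pbeg p) \in rsubs p.
Proof. by apply/rsubsP; exists p; rewrite pcomp_pidr eqxx. Qed.

Lemma rsubs_pbeg v : v \in rsubs p -> pbeg v = pbeg p.
Proof. by case/rsubsP=> w /pbeg_pcomp. Qed.

Lemma rsubs_parr v : v \in rsubs p -> parr v = take (plen v) (parr p).
Proof.
case/rsubsP=> w /pcomp_spec[_ ep].
by rewrite {2}/parr ep /= take_size_cat.
Qed.

Lemma rsubs_plen v : v \in rsubs p -> (plen v <= plen p)%N.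
Proof. by case/rsubsP=> w /plen_pcomp ->; rewrite leq_addr. Qed.

Lemma rsubs_plen_inj v w : v \in rsubs p -> w \in rsubs p ->
  plen v = plen w -> v = w.
Proof.
move=> vp wp e; apply: qpath_eqP; first by rewrite !rsubs_pbeg.
by rewrite (rsubs_parr vp) (rsubs_parr wp) e.
Qed.

Lemma rsubs_pvertices v : v \in rsubs p ->
  pvertices v = take (plen v).+1 (pvertices p).
Proof.
by move=> vp; rewrite /pvertices (rsubs_pbeg vp) /= {1}(rsubs_parr vp) map_take.
Qed.

Lemma rsubs_subseq v : v \in rsubs p -> subseq (pvertices v) (pvertices p).
Proof. by move/rsubs_pvertices->; exact: take_subseq. Qed.

(** This is what keeps the vertex sequence under control in one rewriting
    step: the new endpoint lies beyond the part of [w] that belongs to [v]. *)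
Lemma rsubs_rcons_subseq v w s : v \in rsubs p -> w \in rsubs p ->
  (plen v < plen w)%N -> subseq s (pvertices v) ->
  subseq (rcons s (pend w)) (pvertices w).
Proof.
move=> vp wp lt_vw sv.
have Ew : pvertices w = rcons (take (plen w) (pvertices w)) (pend w).
  have := lastI (pbeg w) [seq tgt a | a <- parr w].
  rewrite -/(pvertices w) -/(pend w) => Ew; rewrite Ew; congr rcons.
  by rewrite -cats1 take_size_cat // size_belast size_map.
rewrite Ew -!cats1 cat_subseq //; apply: subseq_trans sv _.
rewrite (rsubs_pvertices vp) (rsubs_pvertices wp) take_takel //.
by rewrite -(take_takel _ lt_vw) take_subseq.
Qed.

(** A route on [p] must keep the vertices of its left factor in order; the
    hypothesis on the starting vertex is needed because a path may fail to be
    a route for starting in the wrong place only. *)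
Lemma routePn_pcomp q u r : pcomp q u = Some r -> ~~ route p q ->
  pbeg q = pbeg p -> ~~ route p r.
Proof.
move=> Er; rewrite /route => + eq; rewrite eq eqxx andTb; apply: contra.
by case/andP=> _; apply: subseq_trans; exact: subseq_pvertices_pcomp Er.
Qed.

(** The trichotomy behind the rewriting: if [r] is a route, then its last vertex
    occurs in [p] after the end of [u], and the initial segment of [p] that stops
    there is the longer right subpath required of a detour. *)
Lemma arrow_rsub_route a u r : u \in rsubs p -> pcomp (parrow a) u = Some r ->
  r \notin rsubs p -> route p r -> detour p a u.
Proof.
move=> up Er rp; rewrite /route => /andP[_ r_route]; rewrite /detour up Er /=.
apply/andP; split.
  by apply: contra rp => /mapP[v vp [->]].
have: tgt a \in drop (plen u).+1 (pvertices p).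
  move: r_route; rewrite (pvertices_arrow Er) (rsubs_pvertices up).
  rewrite -[X in subseq _ X](cat_take_drop (plen u).+1 (pvertices p)).
  by rewrite -cats1 subseq_cat2l sub1seq.
case/(nthP (tgt a)) => i; rewrite size_drop nth_drop => lt_i ei.
set m := ((plen u).+1 + i)%N in ei.
have szp : size (pvertices p) = (plen p).+1 by rewrite /= size_map.
have le_m : (m <= plen p)%N.
  by rewrite -ltnS -szp /m -ltn_subRL.
have wm : walk (pbeg p) (take m (parr p)).
  have := valP p; rewrite /= -/(pbeg p) -/(parr p) -{1}(cat_take_drop m (parr p)).
  by rewrite walk_cat => /andP[].
pose v := @QPath G (pbeg p, take m (parr p)) wm.
have sv : plen v = m by rewrite /plen {1}/parr /= size_takel.
have vp : v \in rsubs p.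
  rewrite mem_pmap_sub; apply/mapP; exists m => //.
  by rewrite mem_iota /= add0n ltnS.
apply/hasP; exists v => //; rewrite sv /m addn1 leq_addr /= -ei.
have := rsubs_pvertices vp; rewrite sv => Ev.
rewrite -(nth_take _ (ltnSn m)) -Ev /pend -nth_last /= /pvertices size_map.
by rewrite -/(plen v) sv /= (set_nth_default (tgt a)) //= size_map -/(plen v) sv.
Qed.
End RightSubpaths.
End Combinatorics.

(** * Linear algebra of the path algebra *)

Section LinearExtension.
Variables (R : comNzRingType) (G : quiver).
Local Notation A := (pathAlg R G).
Implicit Types (f g x y z : A) (q r : qpath G) (h : qpath G -> A).

Definition pa_lin h z : A := \sum_(q <- psupp z) pcoef z q *: h q.

Lemma pa_linw h (d : {fset qpath G}) z : (psupp z `<=` d)%fset ->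
  pa_lin h z = \sum_(q <- d) pcoef z q *: h q.
Proof.
move=> le_d; rewrite /pa_lin; apply: big_fset_incl => // q _ /pcoef_outdom ->.
by rewrite scale0r.
Qed.

Fact pa_lin_is_linear h : linear (pa_lin h).
Proof.
move=> a x y; set d := (psupp x `|` psupp y)%fset.
rewrite (@pa_linw _ d (a *: x + y)); last first.
  apply: fsubset_trans (psuppD_le _ _) _.
  by apply: fsetSU; exact: psuppZ_le.
rewrite (@pa_linw _ d x) ?fsubsetUl // (@pa_linw _ d y) ?fsubsetUr //.
rewrite scaler_sumr -big_split; apply: eq_bigr => q _ /=.
by rewrite pcoefD pcoefZ scalerDl scalerA.
Qed.

HB.instance Definition _ h :=
  GRing.isLinear.Build R A A *:%R (pa_lin h) (pa_lin_is_linear h).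

Lemma pa_lin_pelt h q : pa_lin h (pelt q) = h q.
Proof. by rewrite /pa_lin psupp_pelt big_seq_fset1 pcoef_pelt eqxx scale1r. Qed.

Lemma pa_scaleAr a x y : x * (a *: y) = a *: (x * y).
Proof. exact: pa_mulZr. Qed.

Lemma pa_scaleAl a x y : (a *: x) * y = a *: (x * y).
Proof. exact: pa_mulZl. Qed.

Lemma mul_pelt q r : pelt q * pelt r = oapp (@pelt R G) 0 (pcomp q r).
Proof. exact: pa_mul_pelt. Qed.

Lemma mul_scale1 a x : ((a *: (1 : A) : A) * x : A) = a *: x.
Proof. by rewrite pa_scaleAl mul1r. Qed.

(** Supports are bounded through coefficients, so that [P] may be any property of
    paths and cancellation in sums does no harm. *)
Definition pa_in (P : qpath G -> Prop) f := forall q, pcoef f q != 0 -> P q.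

Lemma pa_inW (P Q : qpath G -> Prop) f :
  (forall q, P q -> Q q) -> pa_in P f -> pa_in Q f.
Proof. by move=> PQ Pf q /Pf /PQ. Qed.

Lemma pa_in0 P : pa_in P 0. Proof. by move=> q; rewrite pcoef0 eqxx. Qed.

Lemma pa_inD P f g : pa_in P f -> pa_in P g -> pa_in P (f + g).
Proof.
move=> Pf Pg q; rewrite pcoefD; have [->|/Pf //] := eqVneq (pcoef f q) 0.
by rewrite add0r; exact: Pg.
Qed.

Lemma pa_inZ P a f : pa_in P f -> pa_in P (a *: f).
Proof.
by move=> Pf q; rewrite pcoefZ; have [->|/Pf //] := eqVneq (pcoef f q) 0;
  rewrite mulr0 eqxx.
Qed.

Lemma pa_in_pelt (P : qpath G -> Prop) q : P q -> pa_in P (pelt q).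
Proof.
by move=> Pq r; rewrite pcoef_pelt; case: (eqVneq q r) => [<- //|]; rewrite eqxx.
Qed.

Lemma pa_in_sum (P : qpath G -> Prop) (T : Type) (s : seq T) (D : pred T)
    (F : T -> A) :
  (forall i, D i -> pa_in P (F i)) -> pa_in P (\sum_(i <- s | D i) F i).
Proof.
by move=> PF; elim/big_ind: _ => //; [exact: pa_in0|exact: pa_inD].
Qed.

Lemma pa_in_ind (P : qpath G -> Prop) (C : A -> Prop) :
  C 0 -> (forall f g, C f -> C g -> C (f + g)) ->
  (forall a q, P q -> C (a *: pelt q)) -> forall f, pa_in P f -> C f.
Proof.
move=> C0 CD CZ f Pf; rewrite [f]pathAlgE; elim/big_ind: _ => // q _.
by have [->|/Pf/CZ//] := eqVneq (pcoef f q) 0; rewrite scale0r.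
Qed.

Lemma pa_in_lin (P Q : qpath G -> Prop) h f :
  (forall q, P q -> pa_in Q (h q)) -> pa_in P f -> pa_in Q (pa_lin h f).
Proof.
move=> PQ; elim/pa_in_ind: f / => [|f g|a q Pq].
- by rewrite linear0; exact: pa_in0.
- by rewrite linearD; exact: pa_inD.
- by rewrite linearZ /= pa_lin_pelt; apply: pa_inZ; exact: PQ.
Qed.

Lemma pa_in_mul (P Q S : qpath G -> Prop) x y :
  (forall q r w, P q -> Q r -> pcomp q r = Some w -> S w) ->
  pa_in P x -> pa_in Q y -> pa_in S (x * y).
Proof.
move=> PQ; elim/pa_in_ind: x / => [|f g IHf IHg Qy|a q Pq].
- by rewrite mul0r => _; exact: pa_in0.
- by rewrite mulrDl; apply: pa_inD; [exact: IHf|exact: IHg].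
elim/pa_in_ind: y / => [|f g IHf IHg|b r Qr].
- by rewrite mulr0; exact: pa_in0.
- by rewrite mulrDr; exact: pa_inD.
rewrite pa_scaleAl pa_scaleAr mul_pelt; do 2 apply: pa_inZ.
case E: (pcomp q r) => [w|] /=; last exact: pa_in0.
by apply: pa_in_pelt; exact: PQ E.
Qed.

(** Elements supported on a finite family of distinct paths are determined by
    their coefficients along this family. *)
Lemma pa_in_sumE (T : finType) (v_ : T -> qpath G) f :
  injective v_ -> pa_in (fun q => exists i, q = v_ i) f ->
  f = \sum_i pcoef f (v_ i) *: pelt (v_ i).
Proof.
move=> v_inj fv; apply/pathAlgP => w; rewrite [RHS]pcoef_sum.
have coefE i : pcoef (pcoef f (v_ i) *: pelt (v_ i)) w
    = pcoef f w * (v_ i == w)%:R.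
  by rewrite pcoefZ pcoef_pelt; case: eqP => [->|_]; rewrite ?mulr0.
rewrite (eq_bigr _ (fun i _ => coefE i)) -mulr_sumr.
have [->|/fv[i ->]] := eqVneq (pcoef f w) 0; first by rewrite mul0r.
rewrite (bigD1 i) //= eqxx big1 ?addr0 ?mulr1 // => j nj.
by rewrite (inj_eq v_inj) (negPf nj).
Qed.

Lemma pcoef_sum_inj (T : finType) (v_ : T -> qpath G) (a : T -> R) j :
  injective v_ -> pcoef (\sum_i a i *: pelt (v_ i)) (v_ j) = a j.
Proof.
move=> v_inj; rewrite pcoef_sum (bigD1 j) //= pcoefZ pcoef_pelt eqxx mulr1.
rewrite big1 ?addr0 // => i ni.
by rewrite pcoefZ pcoef_pelt (inj_eq v_inj) (negPf ni) mulr0.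
Qed.
End LinearExtension.

Section EndVertices.
Variables (R : comNzRingType) (G : quiver).

Lemma mul_pelt_pend (q : qpath G) x (f : pathAlg R G) :
  pa_in (fun w => pend w = x) f -> x != pbeg q -> pelt q * f = 0.
Proof.
move=> fx nx; elim/pa_in_ind: f / fx => [|f g ef eg|b w ew].
- exact: mulr0.
- by rewrite mulrDr ef eg addr0.
by rewrite pa_scaleAr mul_pelt pcomp_none ?ew ?scaler0.
Qed.

Lemma mul_pid_pend x (f : pathAlg R G) :
  pa_in (fun w => pend w = x) f -> pelt (pid x) * f = f.
Proof.
elim/pa_in_ind: f / => [|f g ef eg|b w ew].
- exact: mulr0.
- by rewrite mulrDr ef eg.
by rewrite pa_scaleAr mul_pelt pcomp_pidl ew eqxx.
Qed.
End EndVertices.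

(** * Change of coefficients *)

Section BaseChange.
Variables (R S : comNzRingType) (G : quiver) (phi : {rmorphism R -> S}).
Local Notation "z ^phi" := (pa_map phi z) (at level 2, format "z ^phi").

Lemma pcoef_map (z : pathAlg R G) q : pcoef z^phi q = phi (pcoef z q).
Proof.
rewrite /pa_map pcoef_sum [in RHS](pathAlgE z) pcoef_sum rmorph_sum.
by apply: eq_bigr => r _; rewrite !pcoefZ !pcoef_pelt rmorphM rmorph_nat.
Qed.

Lemma pa_map0 : (0 : pathAlg R G)^phi = 0.
Proof. by apply/pathAlgP => q; rewrite pcoef_map !pcoef0 rmorph0. Qed.

Lemma pa_mapD (x y : pathAlg R G) : (x + y)^phi = x^phi + y^phi.
Proof. by apply/pathAlgP => q; rewrite pcoef_map !pcoefD !pcoef_map rmorphD. Qed.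

Lemma pa_mapZ a (x : pathAlg R G) : (a *: x)^phi = phi a *: x^phi.
Proof. by apply/pathAlgP => q; rewrite pcoef_map !pcoefZ pcoef_map rmorphM. Qed.

Lemma pa_map_pelt (r : qpath G) : (pelt r : pathAlg R G)^phi = pelt r.
Proof. by apply/pathAlgP => q; rewrite pcoef_map !pcoef_pelt rmorph_nat. Qed.

Lemma pa_map_sum (T : Type) (s : seq T) (P : pred T) (F : T -> pathAlg R G) :
  (\sum_(i <- s | P i) F i)^phi = \sum_(i <- s | P i) (F i)^phi.
Proof. exact: (big_morph _ pa_mapD pa_map0). Qed.

Lemma pa_mapM (x y : pathAlg R G) : (x * y)^phi = x^phi * y^phi.
Proof.
elim/pathAlg_ind: x => [|f g IHf IHg|a q].
- by rewrite mul0r pa_map0 mul0r.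
- by rewrite mulrDl !pa_mapD mulrDl IHf IHg.
elim/pathAlg_ind: y => [|f g IHf IHg|b r].
- by rewrite mulr0 pa_map0 mulr0.
- by rewrite mulrDr !pa_mapD mulrDr IHf IHg.
rewrite !(pa_scaleAl, pa_scaleAr, pa_mapZ, pa_map_pelt, mul_pelt).
by case: (pcomp q r) => [w|] /=; rewrite ?pa_map_pelt ?pa_map0.
Qed.

Lemma pa_map_lin (h : qpath G -> pathAlg R G) (h' : qpath G -> pathAlg S G) z :
  (forall q, (h q)^phi = h' q) -> (pa_lin h z)^phi = pa_lin h' z^phi.
Proof.
move=> hh'; elim/pathAlg_ind: z => [|f g IHf IHg|a q].
- by rewrite !(pa_map0, linear0).
- by rewrite linearD !pa_mapD linearD /= IHf IHg.
- by rewrite linearZ /= !pa_mapZ linearZ /= pa_map_pelt !pa_lin_pelt hh'.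
Qed.
End BaseChange.

(** * Spans *)

Section SpanTheory.
Variables (R : pzRingType) (V : lmodType R) (S : V -> Prop).

Lemma span0 : span S 0.
Proof. by exists [::]; split=> //; rewrite big_nil. Qed.

Lemma spanD u v : span S u -> span S v -> span S (u + v).
Proof.
by move=> /asboolP Su /asboolP Sv; apply/asboolP; exact: (@rpredD _ (spanp S)).
Qed.

Lemma spanZ a v : span S v -> span S (a *: v).
Proof. by move=> /asboolP Sv; apply/asboolP; exact: (@rpredZ _ _ (spanp S)). Qed.

Lemma span_gen v : S v -> span S v.
Proof.
move=> Sv; exists [:: (1, v)]; split; last by rewrite big_seq1 scale1r.
by move=> x; rewrite inE => /eqP->.
Qed.

Lemma span_ind (C : V -> Prop) :
  C 0 -> (forall u v, C u -> C v -> C (u + v)) ->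
  (forall a v, S v -> C (a *: v)) -> forall v, span S v -> C v.
Proof.
move=> C0 CD CZ v [s [sS ->]]; rewrite big_seq.
by elim/big_ind: _ => // x /sS; exact: CZ.
Qed.
End SpanTheory.

(** * The normal form modulo the substitution ideal *)

Section NormalForm.
Variables (G : quiver) (p : qpath G) (R : comNzRingType) (c : Xidx p -> R).
Local Notation A := (pathAlg R G).
Local Notation e1 := (pid (pbeg p)).
Implicit Types (f g x y z : A) (q r u v w : qpath G) (a : arrow G).
Local Notation Lc := (subst_ideal c).

Lemma subst_ideal0 : Lc 0. Proof. exact: span0. Qed.

Lemma subst_idealD x y : Lc x -> Lc y -> Lc (x + y).
Proof. exact: spanD. Qed.

Lemma subst_idealM x y : Lc y -> Lc (x * y).
Proof. exact: spanZ. Qed.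

Lemma subst_idealZ b y : Lc y -> Lc (b *: y).
Proof. by move/(subst_idealM (b *: (1 : A) : A)); rewrite mul_scale1. Qed.

Lemma subst_ideal_route q : ~~ route p q -> Lc (pelt q).
Proof. by move=> rq; apply: span_gen; left; exists q. Qed.

Lemma subst_ideal_drel d : Lc (drel c d).
Proof. by apply: span_gen; right; exists d. Qed.

Definition detour_sum (d : detours p) : A :=
  \sum_(i : Idx d) c (Tagged (@Idx G p) i) *: pelt (vpath i).

(** One substitution.  At most one detour (a, u) satisfies au = q, so the outer
    sum has at most one term; it is empty for non-routes, which go to 0. *)
Definition red_path q : A :=
  if q \in rsubs p then pelt q else
  \sum_(d : detours p | pcomp (parrow (darrow d)) (dpath d) == Some q)
    detour_sum d.

(** Rewrite after each arrow, starting from the vertex at the right end; paths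
    that do not start with [p] are no routes and give 0. *)
Definition nf_path q : A :=
  foldl (fun f a => pa_lin red_path (pelt (parrow a) * f))
    (if pbeg q == pbeg p then pelt e1 else 0) (parr q).

Definition nf : A -> A := pa_lin nf_path.
HB.instance Definition _ := GRing.Linear.copy nf nf.

Lemma nf_pelt_pid (x : vertex G) :
  nf (pelt (pid x)) = if x == pbeg p then pelt e1 else 0.
Proof. by rewrite /nf pa_lin_pelt. Qed.

Lemma nf_pelt_arrow a q r : pcomp (parrow a) q = Some r ->
  nf (pelt r) = pa_lin red_path (pelt (parrow a) * nf (pelt q)).
Proof.
case/pcomp_spec=> _ er; rewrite /nf !pa_lin_pelt /nf_path {1}/pbeg {1}/parr er /=.
by rewrite cats1 foldl_rcons.
Qed.

Lemma dpath_rsubs (d : detours p) : dpath d \in rsubs p.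
Proof. by case/and4P: (valP d). Qed.

Lemma vpath_rsubs (d : detours p) (i : Idx d) : vpath i \in rsubs p.
Proof. exact: ssvalP. Qed.

Lemma vpath_plen (d : detours p) (i : Idx d) : (plen (dpath d) < plen (vpath i))%N.
Proof. by case/andP: (valP i). Qed.

Lemma vpath_pend (d : detours p) (i : Idx d) : pend (vpath i) = tgt (darrow d).
Proof. by case/andP: (valP i) => _ /eqP. Qed.

Lemma red_path_rsub q : q \in rsubs p -> red_path q = pelt q.
Proof. by rewrite /red_path => ->. Qed.

Lemma red_path_detour (d : detours p) q :
  pcomp (parrow (darrow d)) (dpath d) = Some q -> red_path q = detour_sum d.
Proof.
move=> Eq; rewrite /red_path ifN; last first.
  have /and4P[_ _ nd _] := valP d; apply: contra nd => qp.
  by apply/mapP; exists q.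
rewrite (big_pred1 d) // => d'; apply/eqP/eqP => [Eq'|-> //].
have [ea eu] := pcomp_arrow_inj Eq' Eq; apply: val_inj.
move: ea eu; rewrite /darrow /dpath; case: (val d') (val d) => a' u' [a u] /= ->.
by move=> eu; congr pair; apply: val_inj.
Qed.

Lemma red_path_in a u q : u \in rsubs p -> pcomp (parrow a) u = Some q ->
  pa_in (fun w => [/\ w \in rsubs p, pend w = tgt a & (plen u < plen w)%N])
    (red_path q).
Proof.
move=> up Eq; rewrite /red_path; case: ifPn => [qp|_].
  apply: pa_in_pelt; split=> //; first exact: pend_arrow Eq.
  by rewrite (plen_pcomp Eq) addn1.
apply: pa_in_sum => d /eqP Ed; have [ea eu] := pcomp_arrow_inj Ed Eq.
apply: pa_in_sum => i _; apply: pa_inZ; apply: pa_in_pelt.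
by rewrite vpath_rsubs vpath_pend ea -eu vpath_plen.
Qed.

(** By induction on the last arrow.  In each step a right subpath is replaced by
    longer ones that end where the new arrow ends, which keeps all these
    properties at once. *)
Lemma nf_path_in q :
  pa_in (fun w => [/\ w \in rsubs p, pend w = pend q, (plen q <= plen w)%N,
    pbeg q = pbeg p & subseq (pvertices q) (pvertices w)]) (nf (pelt q)).
Proof.
elim/qpath_arrow_ind: q => [x|a q r Er IHq].
  rewrite nf_pelt_pid; case: eqP => [->|_]; last exact: pa_in0.
  by apply: pa_in_pelt; split=> //; exact: rsubs_pid.
rewrite (nf_pelt_arrow Er); elim/pa_in_ind: (nf (pelt q)) / IHq => [|f g|b u].
- by rewrite mulr0 linear0; exact: pa_in0.
- by rewrite mulrDr linearD; exact: pa_inD.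
case=> up eu le_u bq sq; rewrite pa_scaleAr linearZ mul_pelt /=; apply: pa_inZ.
case Es: (pcomp (parrow a) u) => [s|] /=; last by rewrite linear0; exact: pa_in0.
rewrite pa_lin_pelt; apply: pa_inW (red_path_in up Es) => w [wp ew lt_uw].
have sw := rsubs_rcons_subseq up wp lt_uw sq.
rewrite ew -(pvertices_arrow Er) in sw.
have lw : (plen r <= plen w)%N.
  by rewrite (plen_pcomp Er) addn1; exact: leq_ltn_trans le_u lt_uw.
by split; rewrite ?(pend_arrow Er) // (pbeg_pcomp Er).
Qed.

Lemma nf_rsub v : v \in rsubs p -> nf (pelt v) = pelt v.
Proof.
elim/qpath_arrow_ind: v => [x /rsubs_pbeg ex|a q r Er IHq rp].
  by rewrite nf_pelt_pid -ex eqxx.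
rewrite (nf_pelt_arrow Er) IHq; last exact: rsubs_pcompr Er rp.
by rewrite mul_pelt Er pa_lin_pelt red_path_rsub.
Qed.

Lemma nf_id f : pa_in (fun w => w \in rsubs p) f -> nf f = f.
Proof.
elim/pa_in_ind: f / => [|f g ef eg|b q qp]; first exact: linear0.
  by rewrite linearD /= ef eg.
by rewrite linearZ /= nf_rsub.
Qed.

(** The paths in the normal form of [q] pass through the vertices of [q] in
    order and are right subpaths of [p], so [q] would be a route if there were
    any. *)
Lemma nf_nonroute q : ~~ route p q -> nf (pelt q) = 0.
Proof.
move=> nq; apply/pathAlgP => w; rewrite pcoef0; apply/eqP; apply: contraNT nq.
case/nf_path_in=> wp _ _ eq sq; rewrite /route eq eqxx andTb.
exact: subseq_trans (rsubs_subseq wp).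
Qed.

Lemma nf_in_rsubs z : pa_in (fun w => w \in rsubs p) (nf z).
Proof.
elim/pathAlg_ind: z => [|f g|b q]; first by rewrite linear0; exact: pa_in0.
  by rewrite linearD; exact: pa_inD.
rewrite linearZ; apply: pa_inZ.
by apply: pa_inW (@nf_path_in q) => w [].
Qed.

Lemma nf_in_plen n z : pa_in (fun w => n <= plen w)%N z ->
  pa_in (fun w => n <= plen w)%N (nf z).
Proof.
apply: pa_in_lin => q le_q; rewrite -pa_lin_pelt -/(nf _).
by apply: pa_inW (@nf_path_in q) => w [_ _ /(leq_trans le_q)].
Qed.

Lemma nf_long z : pa_in (fun w => plen p < plen w)%N z -> nf z = 0.
Proof.
move=> /nf_in_plen long; apply/pathAlgP => w; rewrite pcoef0; apply/eqP.
apply: contraTT isT => nz; have := long w nz; rewrite ltnNge.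
by rewrite (rsubs_plen (nf_in_rsubs nz)).
Qed.

(** Multiplication by an arrow can be carried out after normalizing: this makes
    the kernel of the normal form a left ideal, see [nf0_mul]. *)
Lemma nf_arrowM a z :
  nf (pelt (parrow a) * z) = pa_lin red_path (pelt (parrow a) * nf z).
Proof.
elim/pathAlg_ind: z => [|f g IHf IHg|b q].
- by rewrite !(mulr0, linear0).
- by rewrite mulrDr !linearD /= IHf IHg -linearD -mulrDr.
rewrite linearZ /= !pa_scaleAr !linearZ /= mul_pelt; congr (_ *: _).
have := @nf_path_in q; case: (eqVneq (pend q) (pbeg (parrow a))) => [eq|nq] wq.
  by have [r Er] := pcomp_some eq; rewrite Er; exact: nf_pelt_arrow.
rewrite pcomp_none // linear0 (mul_pelt_pend _ nq) ?linear0 //.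
by apply: pa_inW wq => w [].
Qed.

Lemma nf_pidM (x : vertex G) z : nf (pelt (pid x) * z) = pelt (pid x) * nf z.
Proof.
elim/pathAlg_ind: z => [|f g IHf IHg|b q].
- by rewrite !(mulr0, linear0, mulr0).
- by rewrite mulrDr !linearD /= IHf IHg mulrDr.
rewrite linearZ /= !pa_scaleAr !linearZ /= mul_pelt pcomp_pidl; congr (_ *: _).
have wq : pa_in (fun w => pend w = pend q) (nf (pelt q)).
  by apply: pa_inW (@nf_path_in q) => w [].
case: eqP => [<-|/eqP nq]; first by rewrite mul_pid_pend.
by rewrite (@mul_pelt_pend _ _ (pid x) _ _ wq nq) linear0.
Qed.

Lemma nf0_mul x z : nf z = 0 -> nf (x * z) = 0.
Proof.
move=> z0; elim/pathAlg_ind: x => [|f g IHf IHg|b q].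
- by rewrite mul0r linear0.
- by rewrite mulrDl linearD /= IHf IHg addr0.
rewrite pa_scaleAl linearZ /= (_ : nf _ = 0) ?scaler0 //.
elim/qpath_arrow_ind: q => [y|a q r Er IHq]; first by rewrite nf_pidM z0 mulr0.
rewrite (_ : pelt r = pelt (parrow a) * pelt q); last by rewrite mul_pelt Er.
by rewrite -mulrA nf_arrowM IHq mulr0 linear0.
Qed.

Lemma nf_subst_ideal z : Lc z -> nf z = 0.
Proof.
elim/span_ind: z / => [|x y /= ex ey|x y Sy]; first exact: linear0.
  by rewrite linearD /= ex ey addr0.
apply: nf0_mul; case: Sy => [[q nq ->]|[d ->]]; first exact: nf_nonroute.
rewrite linearB /= nf_arrowM (nf_rsub (dpath_rsubs d)).
rewrite nf_id; last first.
  by apply: pa_in_sum => i _; apply: pa_inZ; apply: pa_in_pelt; exact: vpath_rsubs.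
have [r Er] : exists r, pcomp (parrow (darrow d)) (dpath d) = Some r.
  have /and4P[_ + _ _] := valP d; rewrite /darrow /dpath.
  by case: pcomp => // r _; exists r.
by rewrite mul_pelt Er pa_lin_pelt (red_path_detour Er) subrr.
Qed.

(** A rewriting step replaces an extension of a right subpath by something that
    differs from it by a generator of the ideal; left multiplication by the
    remaining arrows stays in the ideal. *)
Lemma subst_ideal_nf z : Lc (z - nf z).
Proof.
have sumD f g f' g' : Lc (f - f') -> Lc (g - g') -> Lc (f + g - (f' + g')).
  by move=> Lf Lg; rewrite opprD addrACA; exact: subst_idealD.
have stepL a f : pa_in (fun w => w \in rsubs p) f ->
    Lc (pelt (parrow a) * f - pa_lin red_path (pelt (parrow a) * f)).
  elim/pa_in_ind: f / => [|f g|b u up].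
  - by rewrite mulr0 linear0 subr0; exact: subst_ideal0.
  - by rewrite mulrDr linearD; exact: sumD.
  rewrite pa_scaleAr linearZ -scalerBr mul_pelt; apply: subst_idealZ.
  case Er: (pcomp (parrow a) u) => [r|] /=; last first.
    by rewrite linear0 subr0; exact: subst_ideal0.
  rewrite pa_lin_pelt; have [rp|rp] := boolP (r \in rsubs p).
    by rewrite red_path_rsub // subrr; exact: subst_ideal0.
  have [d /eqP Ed|nd] := pickP
      (fun d : detours p => pcomp (parrow (darrow d)) (dpath d) == Some r).
    rewrite (red_path_detour Ed).
    by have := subst_ideal_drel d; rewrite /drel mul_pelt Ed.
  rewrite /red_path (negPf rp) big_pred0 // subr0; apply: subst_ideal_route.
  apply/negP => /(arrow_rsub_route up Er rp) du.
  by have := nd (exist _ (a, SeqSub up) du); rewrite /darrow /dpath /= Er eqxx.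
elim/pathAlg_ind: z => [|f g IHf IHg|b q].
- by rewrite linear0 subr0; exact: subst_ideal0.
- by rewrite linearD; exact: sumD.
rewrite linearZ /= -scalerBr; apply: subst_idealZ.
elim/qpath_arrow_ind: q => [x|a q r Er IHq].
  rewrite nf_pelt_pid; case: eqP => [->|/eqP nx].
    by rewrite subrr; exact: subst_ideal0.
  by rewrite subr0; apply: subst_ideal_route; rewrite /route negb_and nx.
rewrite (nf_pelt_arrow Er).
have -> : pelt r = pelt (parrow a) * pelt q :> A by rewrite mul_pelt Er.
rewrite -(subrKA (pelt (parrow a) * nf (pelt q))) -mulrBr.
by apply: subst_idealD; [exact: subst_idealM|exact/stepL/nf_in_rsubs].
Qed.

(** This gives both existence and uniqueness of the reduction to right subpaths:
    such combinations are their own normal forms. *)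
Lemma subst_idealP z : Lc z <-> nf z = 0.
Proof.
split; first exact: nf_subst_ideal.
by move=> z0; have := subst_ideal_nf z; rewrite z0 subr0.
Qed.

Lemma nf_nf z : nf (nf z) = nf z.
Proof. exact/nf_id/nf_in_rsubs. Qed.

Lemma nf_mul_nf x z : nf (x * nf z) = nf (x * z).
Proof.
apply/eqP; rewrite -subr_eq0 -linearB -mulrBr; apply/eqP/nf0_mul.
by rewrite linearB /= nf_nf subrr.
Qed.

(** A path that does not start in e1 is no route, so that both sides vanish. *)
Lemma nf_mule1 z : nf (z * pelt e1) = nf z.
Proof.
elim/pathAlg_ind: z => [|f g IHf IHg|a q].
- by rewrite mul0r.
- by rewrite mulrDl !linearD /= IHf IHg.
rewrite pa_scaleAl !linearZ /= mul_pelt pcomp_pidr; case: eqP => //= /eqP nq.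
by rewrite linear0 (@nf_nonroute q) // /route negb_and nq.
Qed.

Lemma nf_one : nf 1 = pelt e1.
Proof. by rewrite -nf_mule1 mul1r nf_rsub // rsubs_pid. Qed.

Lemma nf_rsub_sum z :
  nf z = \sum_(v : rsub p) pcoef (nf z) (ssval v) *: pelt (ssval v).
Proof.
apply: pa_in_sumE => [|w /nf_in_rsubs wp]; first exact: val_inj.
by exists (SeqSub wp).
Qed.
End NormalForm.

(** * Normal forms and evaluation of coefficients *)

Section NormalFormBaseChange.
Variables (G : quiver) (p : qpath G) (R S : comNzRingType).
Variables (phi : {rmorphism R -> S}) (c : Xidx p -> R) (c' : Xidx p -> S).
Hypothesis cc' : forall x, phi (c x) = c' x.

Lemma pa_map_red_path q : pa_map phi (red_path c q) = red_path c' q.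
Proof.
rewrite /red_path; case: ifP => _; first exact: pa_map_pelt.
rewrite pa_map_sum; apply: eq_bigr => d _; rewrite pa_map_sum.
by apply: eq_bigr => i _; rewrite pa_mapZ pa_map_pelt cc'.
Qed.

Lemma pa_map_nf z : pa_map phi (nf c z) = nf c' (pa_map phi z).
Proof.
apply: pa_map_lin => q.
suff: pa_map phi (nf c (pelt q)) = nf c' (pelt q) by rewrite /nf !pa_lin_pelt.
elim/qpath_arrow_ind: q => [x|a q r Er IHq].
  by rewrite !nf_pelt_pid; case: ifP => _; rewrite ?pa_map_pelt ?pa_map0.
rewrite !(nf_pelt_arrow _ Er) -IHq.
by rewrite (pa_map_lin _ pa_map_red_path) pa_mapM pa_map_pelt.
Qed.
End NormalFormBaseChange.

Section Evaluation.
Variables (K : fieldType) (V : finType) (k : V -> K).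

Fact peval_is_zmod_morphism : zmod_morphism (peval k).
Proof. exact: mpoly.mevalB. Qed.

Fact peval_is_monoid_morphism : monoid_morphism (peval k).
Proof. by split; [exact: mpoly.meval1|exact: mpoly.mevalM]. Qed.

HB.instance Definition _ := GRing.isZmodMorphism.Build (polyring K V) K
  (peval k) peval_is_zmod_morphism.
HB.instance Definition _ := GRing.isMonoidMorphism.Build (polyring K V) K
  (peval k) peval_is_monoid_morphism.

Lemma peval_pvar v : peval k (pvar K v) = k v.
Proof. by rewrite /peval /pvar mpoly.mevalXU enum_rankK. Qed.

Lemma peval_pconst a : peval k (pconst V a) = a.
Proof. exact: mpoly.mevalC. Qed.
End Evaluation.

Lemma pa_mapK (R S : comNzRingType) (G : quiver)
    (f : R -> S) (g : {rmorphism S -> R}) (z : pathAlg R G) :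
  cancel f g -> pa_map g (pa_map f z) = z.
Proof.
move=> fK; rewrite {2}/pa_map pa_map_sum [RHS]pathAlgE; apply: eq_bigr => q _.
by rewrite pa_mapZ pa_map_pelt fK.
Qed.

(** * Relations hold in the normal form at points of the variety *)

(** If a nil left ideal N were not contained in the maximal left ideal M, then
    1 = m + n for some m in M and n in N.  Multiplying by powers of n shows that
    n ^ i is in M as soon as n ^ (i+1) is; as n is nilpotent, 1 is in M. *)
Lemma nil_left_ideal_jacobson (A : pzRingType) (N : A -> Prop) x :
  left_ideal N -> (forall y, N y -> exists m, y ^+ m = 0) -> N x -> jacobson x.
Proof.
move=> [N0 ND NM] nilN Nx M [[M0 MD MM] M1 Mmax].
pose MN y := exists2 m, M m & exists2 n, N n & y = m + n.
have MNx : MN x by exists 0 => //; exists x => //; rewrite add0r.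
apply: (Mmax MN) MNx.
- split.
  + by exists 0 => //; exists 0 => //; rewrite addr0.
  + move=> _ _ [m Mm [n Nn ->]] [m' Mm' [n' Nn' ->]].
    by exists (m + m'); [exact: MD|exists (n + n'); [exact: ND|exact: addrACA]].
  + move=> a _ [m Mm [n Nn ->]].
    by exists (a * m); [exact: MM|exists (a * n); [exact: NM|exact: mulrDr]].
- by move=> m Mm; exists m => //; exists 0 => //; rewrite addr0.
move=> [m Mm [n /nilN[j nj] e1]]; apply: M1.
elim: j nj => [|j IHj] nj; first by rewrite -(expr0 n) nj.
have Mn i : M (n ^+ i.+1) -> M (n ^+ i).
  by move=> Mni; rewrite -[n ^+ i]mulr1 e1 mulrDr -exprSr; apply: MD => //; exact: MM.
have : M (n ^+ j.+1) by rewrite nj.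
by elim: j.+1 => [|i IHi]; [rewrite expr0|move/Mn/IHi].
Qed.

Section QuotientPowers.
Variables (A : pzRingType) (I : ideal A).
Local Notation pi := (quotring_pi I).

Lemma quotring_pi0 : pi 0 = 0.
Proof. by rewrite -(subrr 0) quotring_piB subrr. Qed.

Lemma quotring_piM x y : pi (x * y) = pi x * pi y.
Proof. by rewrite [RHS](quotring_mul_pi I). Qed.

Lemma quotring_piX x n : pi (x ^+ n) = pi x ^+ n.
Proof. by elim: n => // n IHn; rewrite !exprS quotring_piM IHn. Qed.

Lemma quotring_pi_eq0 x : pi x = 0 <-> I x.
Proof. by rewrite -quotring_pi0 quotring_pi_eq subr0. Qed.

Lemma idealD x y : I x -> I y -> I (x + y).
Proof.
move=> Ix Iy; rewrite -[y]opprK; apply: idealB => //.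
by rewrite -sub0r; apply: idealB => //; exact: ideal0.
Qed.
End QuotientPowers.

Section AdmissibleIdeal.
Variables (K : fieldType) (G : quiver) (I : ideal (pathAlg K G)).
Local Notation A := (pathAlg K G).
Local Notation pi := (quotring_pi I).
Implicit Types (q r : qpath G) (z : A).

Lemma ideal_pa_in P z : (forall q, P q -> I (pelt q)) -> pa_in P z -> I z.
Proof.
move=> IP; elim/pa_in_ind: z / => [|f g|b q /IP Iq]; first exact: ideal0.
  exact: idealD.
by rewrite -mul_scale1; exact: idealMl.
Qed.

Lemma pa_in_exp z n : pa_in (fun q => 0 < plen q)%N z ->
  pa_in (fun q => n <= plen q)%N (z ^+ n).
Proof.
move=> z0; elim: n => [|n IHn].
  by apply: (@pa_inW _ _ (fun=> True)) => // q.
rewrite exprS; apply: pa_in_mul z0 IHn => q r w q0 lr /plen_pcomp->.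
by rewrite -addn1 leq_add.
Qed.

Hypothesis adI : admissible I.

(** The combinations of paths of positive length form a left ideal whose image
    in the quotient is nil, as long paths are relations. *)
Lemma arrow_jacobson a : jacobson (pi (pelt (parrow a))).
Proof.
have [_ [m Im]] := adI.
pose N (x : quotring I) := exists2 z, pa_in (fun q => 0 < plen q)%N z & x = pi z.
apply: (@nil_left_ideal_jacobson _ N); last 1 first.
- by exists (pelt (parrow a)) => //; exact: pa_in_pelt.
- split.
  + by exists 0; [exact: pa_in0|rewrite quotring_pi0].
  + move=> _ _ [x Px ->] [y Py ->].
    by exists (x + y); [exact: pa_inD|rewrite quotring_piD].
  + move=> b _ [x Px ->]; have [y ->] := quotring_piP b.
    exists (y * x); last by rewrite quotring_piM.
    apply: (@pa_in_mul _ _ (fun=> True)) Px => // q r w _ r0 /plen_pcomp->.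
    by rewrite ltn_addr.
move=> _ [z Pz ->]; exists m; rewrite -quotring_piX; apply/quotring_pi_eq0.
exact: (ideal_pa_in Im (pa_in_exp Pz)).
Qed.

(** A path of length L is a product of L arrows, hence in the L-th power of the
    radical; longer paths are left multiples of such. *)
Lemma ideal_loewy L q : loewy_length (quotring I) L -> (L <= plen q)%N ->
  I (pelt q).
Proof.
move=> [JL _].
have Jpow r : ideal_pow (@jacobson (quotring I)) (plen r) (pi (pelt r)).
  elim/qpath_arrow_ind: r => [x //|a r r' Er IHr].
  rewrite (plen_pcomp Er) addn1; exists [:: (pi (pelt (parrow a)), pi (pelt r))].
  split; last by rewrite big_seq1 -quotring_piM mul_pelt Er.
  by move=> y; rewrite inE => /eqP->; split=> //; exact: arrow_jacobson.
have IL r : plen r = L -> I (pelt r).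
  by move=> rL; apply/quotring_pi_eq0/JL; rewrite -rL.
elim/qpath_arrow_ind: q => [x|a q r Er IHq].
  by rewrite leqn0 => /eqP L0; apply: IL.
rewrite leq_eqVlt => /orP[/eqP/esym/IL //|].
rewrite (plen_pcomp Er) addn1 ltnS => /IHq.
have -> : pelt r = pelt (parrow a) * pelt q :> A by rewrite mul_pelt Er.
exact: idealMl.
Qed.

Variables (L s : nat) (t : 'I_s -> A) (p : qpath G) (k : Xidx p -> K).
Hypotheses (loewyL : loewy_length (quotring I) L) (spant : spans_upto I L t).
Hypothesis Vk : Vp t k.

(** The polynomials tau of the variety are the coefficients of the normal form
    with generic parameters, and the normal form commutes with evaluation. *)
Lemma nf_Vp j : nf k (t j) = 0.
Proof.
pose z := pa_map (@pconst K (Xidx p)) (t j).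
pose tau (v : rsub p) := pcoef (nf (pvar K (V := Xidx p)) z) (ssval v).
have tauP : tau_of (t j) tau.
  by rewrite /tau_of /Lideal /tau -nf_rsub_sum; exact: subst_ideal_nf.
rewrite nf_rsub_sum big1 // => v _.
have -> : t j = pa_map (peval k) z.
  by rewrite pa_mapK //; exact: peval_pconst.
rewrite -(@pa_map_nf _ _ _ _ (peval k) (pvar K (V := Xidx p))) ?pcoef_map.
  by rewrite [X in X *: _](Vk tauP v) scale0r.
exact: peval_pvar.
Qed.

(** Cut [z] at length L: the long part consists of left multiples of paths of
    length L, the short part is a combination of the spanning relations. *)
Lemma nf_ideal z : I z -> nf k z = 0.
Proof.
have [_ spanI] := spant.
have nfL y : I y -> (forall q, q \in psupp y -> (plen q <= L)%N) -> nf k y = 0.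
  move=> Iy Ly; have [c ->] := spanI y (conj Iy Ly).
  by rewrite linear_sum big1 // => j _; rewrite linearZ /= nf_Vp scaler0.
have nfL0 q : plen q = L -> nf k (pelt q) = 0.
  move=> qL; apply: nfL; first by apply: ideal_loewy loewyL _; rewrite qL.
  by move=> r; rewrite psupp_pelt in_fset1 => /eqP->; rewrite qL.
have nf_gtL q : (L <= plen q)%N -> nf k (pelt q) = 0.
  elim/qpath_arrow_ind: q => [x|a q r Er IHq].
    by rewrite leqn0 => /eqP L0; apply: nfL0.
  rewrite leq_eqVlt => /orP[/eqP/esym/nfL0 //|].
  rewrite (plen_pcomp Er) addn1 ltnS => /IHq nq.
  have -> : pelt r = pelt (parrow a) * pelt q :> A by rewrite mul_pelt Er.
  exact: nf0_mul.
move=> Iz; set zs := \sum_(q <- psupp z | (L < plen q)%N) pcoef z q *: pelt q.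
have zsP : pa_in (fun q => L < plen q)%N zs.
  by apply: pa_in_sum => q lq; apply: pa_inZ; exact: pa_in_pelt.
have nzs : nf k zs = 0.
  rewrite linear_sum big1 // => q /ltnW lq.
  by rewrite linearZ /= nf_gtL ?scaler0.
have Izs : I zs by apply: ideal_pa_in zsP => q /ltnW; exact: ideal_loewy.
rewrite -(subrK zs z) linearD /= nzs addr0; apply: nfL; first exact: idealB.
have zsE : z - zs = \sum_(q <- psupp z | (plen q <= L)%N) pcoef z q *: pelt q.
  rewrite {1}[z]pathAlgE (bigID (fun q => L < plen q)%N) /= addrAC subrr add0r.
  by apply: eq_bigl => q; rewrite -leqNgt.
have zsL : pa_in (fun q => plen q <= L)%N (z - zs).
  by rewrite zsE; apply: pa_in_sum => q lq; apply: pa_inZ; exact: pa_in_pelt.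
by move=> q; rewrite /psupp -monalg.mcoeff_neq0; exact: zsL.
Qed.
End AdmissibleIdeal.

(** * The modules attached to points of the variety *)

Section QuotientModule.
Variables (A : pzRingType) (V W : lmodType A) (S : V -> Prop).

Definition quotmod_pi (v : V) : quotmod S := \pi_(Quotient.quot (spanp S))%qT v.

Lemma quotmod_piP (x : quotmod S) : exists v, x = quotmod_pi v.
Proof. by exists (repr (x : Quotient.quot (spanp S))); rewrite /quotmod_pi reprK. Qed.

Fact quotmod_pi_is_linear : linear quotmod_pi.
Proof.
move=> a u v; rewrite /quotmod_pi raddfD; congr (_ + _).
exact/esym/quotmod_scale_pi.
Qed.
HB.instance Definition _ :=
  GRing.isLinear.Build A V (quotmod S) *:%R quotmod_pi quotmod_pi_is_linear.

Lemma quotmod_pi_eq0 v : quotmod_pi v = 0 <-> span S v.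
Proof.
rewrite -(linear0 quotmod_pi) /quotmod_pi; split=> [/eqP|Sv]; last apply/eqP.
  by rewrite -Quotient.idealrBE subr0 => /asboolP.
by rewrite -Quotient.idealrBE subr0; apply/asboolP.
Qed.

(** The universal property of the quotient. *)
Lemma quotmod_lift (f : {linear V -> W}) : (forall v, S v -> f v = 0) ->
  exists g : {linear quotmod S -> W}, forall v, g (quotmod_pi v) = f v.
Proof.
move=> fS0; pose g (x : quotmod S) := f (repr (x : Quotient.quot (spanp S))).
have gE v : g (quotmod_pi v) = f v.
  apply/eqP; rewrite -subr_eq0 -linearB /=; apply/eqP.
  have: span S (repr (quotmod_pi v : Quotient.quot (spanp S)) - v).
    apply/quotmod_pi_eq0; rewrite linearB /= {1}/quotmod_pi reprK; exact: subrr.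
  elim/span_ind=> [|x y ex ey|a x Sx]; first exact: linear0.
    by rewrite linearD /= ex ey addr0.
  by rewrite linearZ /= fS0 ?scaler0.
have g_lin : linear g.
  move=> a x y; have [u ->] := quotmod_piP x; have [v ->] := quotmod_piP y.
  by rewrite -linearP !gE linearP.
pose gL := GRing.isLinear.Build A (quotmod S) W *:%R g g_lin.
by exists (HB.pack_for {linear quotmod S -> W} g gL).
Qed.
End QuotientModule.

Lemma inj_surj_bij (T U : Type) (f : T -> U) :
  injective f -> (forall y, exists x, f x = y) -> bijective f.
Proof.
move=> fI fS; exists (fun y => sval (cid (fS y))) => x.
  by apply: fI; exact: svalP (cid (fS (f x))).
exact: svalP (cid (fS x)).
Qed.

Section CyclicModule.
Variables (K : fieldType) (G : quiver) (I : ideal (pathAlg K G)) (p : qpath G).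
Variable k : Xidx p -> K.
Local Notation A := (pathAlg K G).
Local Notation pi := (quotring_pi I).
Local Notation e1 := (pid (pbeg p)).
Implicit Types x y z : A.

(** The class of z e1, that is, [z] applied to the generator. *)
Definition phi_elt z : Phi I k :=
  quotmod_pi (Ugen k) (lprinc_mul (pi (pelt e1)) (pi z)).

Lemma lprinc_mulD (e u v : quotring I) :
  lprinc_mul e (u + v) = lprinc_mul e u + lprinc_mul e v.
Proof. by apply: val_inj; exact: (mulrDl u v e). Qed.

Lemma lprinc_mulZ (e u v : quotring I) :
  lprinc_mul e (u * v) = u *: lprinc_mul e v.
Proof. by apply: val_inj; exact: (esym (mulrA u v e)). Qed.

Lemma lprinc_mulP (e : quotring I) (u : lprinc e) :
  exists z, u = lprinc_mul e (pi z).
Proof.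
have /asboolP[v Ev] := valP u; have [z Ez] := quotring_piP v.
by exists z; apply: val_inj; rewrite /= Ev Ez.
Qed.

Lemma phi_eltD x y : phi_elt (x + y) = phi_elt x + phi_elt y.
Proof. by rewrite /phi_elt quotring_piD lprinc_mulD linearD. Qed.

Lemma phi_eltB x y : phi_elt (x - y) = phi_elt x - phi_elt y.
Proof. by apply/eqP; rewrite eq_sym subr_eq -phi_eltD subrK. Qed.

Lemma phi_eltM x y : phi_elt (x * y) = pi x *: phi_elt y.
Proof. by rewrite /phi_elt quotring_piM lprinc_mulZ linearZ. Qed.

Lemma phi_eltP (m : Phi I k) : exists z, m = phi_elt z.
Proof.
have [u ->] := quotmod_piP m; have [z ->] := lprinc_mulP u.
by exists z.
Qed.

Hypothesis I0 : forall z, I z -> nf k z = 0.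

(** The annihilator of the generator.  The submodule divided out is the image of
    the substitution ideal in the quotient by [I]; as [I] is contained in the
    kernel of the normal form, no other element is killed. *)
Lemma phi_elt_eq0 z : phi_elt z = 0 <-> nf k z = 0.
Proof.
rewrite quotmod_pi_eq0 -subst_idealP; split=> [Uz|]; last first.
  elim/span_ind: z / => [|x y /= Ux Uy|x y Sy].
  - rewrite quotring_pi0 (_ : lprinc_mul _ _ = 0); first exact: span0.
    by apply: val_inj; rewrite /= mul0r.
  - by rewrite quotring_piD lprinc_mulD; exact: spanD.
  rewrite quotring_piM lprinc_mulZ; apply/spanZ/span_gen.
  by case: Sy => [[q nq ->]|[d ->]]; [right; exists q|left; exists d].
(* any representative of an element of the submodule has normal form 0; the
   representative of the class of z at hand is z e1 *)
apply/subst_idealP; suff: forall u : lprinc (pi (pelt e1)), span (Ugen k) u ->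
    forall z, lprinc_val u = pi z -> nf k z = 0.
  by move=> /(_ _ Uz (z * pelt e1)) <-; rewrite ?nf_mule1 //= quotring_piM.
move=> u; elim/span_ind: u / => [|u v IHu IHv|a u Su] y Ey.
- by apply/I0/quotring_pi_eq0; rewrite -Ey.
- have [x Ex] := quotring_piP (lprinc_val u : quotring I).
  have -> : y = x + (y - x) by rewrite addrC subrK.
  rewrite linearD /= (IHu x Ex) (IHv (y - x)) ?addr0 //.
  rewrite quotring_piB -Ey -Ex.
  by apply/esym/eqP; rewrite subr_eq; apply/eqP; exact: addrC.
have [b Eb] := quotring_piP a.
suff [g Eu g0] : exists2 g, u = lprinc_mul (pi (pelt e1)) (pi g) & nf k g = 0.
  rewrite -(subrK (b * (g * pelt e1)) y) linearD /= (nf0_mul b); last first.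
    by rewrite nf_mule1.
  rewrite addr0; apply/I0/quotring_pi_eq0.
  have Eau : lprinc_val (a *: u) = a * (lprinc_val u : quotring I) by [].
  by rewrite quotring_piB -Ey Eau Eu /= Eb !quotring_piM subrr.
case: Su => [[d ->]|[q nq ->]].
  by exists (drel k d) => //; apply/subst_idealP; exact: subst_ideal_drel.
by exists (pelt q) => //; exact: nf_nonroute.
Qed.
End CyclicModule.

Section Homomorphisms.
Variables (K : fieldType) (G : quiver) (I : ideal (pathAlg K G)) (p : qpath G).
Variables k k' : Xidx p -> K.
Hypothesis I0 : forall z, I z -> nf k z = 0.
Hypothesis I0' : forall z, I z -> nf k' z = 0.
Local Notation e1 := (pid (pbeg p)).
Local Notation pi := (quotring_pi I).

(** Right multiplication by [y], which is defined on the left ideal generated by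
    e1 and factors through the quotient. *)
Lemma phi_hom y : (forall z, nf k z = 0 -> nf k' (z * y) = 0) ->
  exists f : {linear Phi I k -> Phi I k'},
    forall z, f (phi_elt I k z) = phi_elt I k' (z * y).
Proof.
move=> ky; pose h (u : lprinc (pi (pelt e1))) : Phi I k' :=
  (lprinc_val u : quotring I) *: phi_elt I k' y.
have h_lin : linear h.
  move=> a u v; have Eau : lprinc_val (a *: u + v)
    = a * (lprinc_val u : quotring I) + (lprinc_val v : quotring I) by [].
  by rewrite /h Eau scalerDl -scalerA.
pose hL := GRing.isLinear.Build _ _ _ *:%R h h_lin.
pose hl := HB.pack_for {linear lprinc (pi (pelt e1)) -> Phi I k'} h hL.
have hE z : h (lprinc_mul (pi (pelt e1)) (pi z)) = phi_elt I k' (z * pelt e1 * y).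
  by rewrite phi_eltM quotring_piM.
have he1 z : nf k z = 0 -> nf k' (z * pelt e1 * y) = 0.
  by move=> z0; apply: ky; rewrite nf_mule1.
have [|g gE] := @quotmod_lift _ _ _ (Ugen k) hl.
  move=> u [[d ->]|[q nq ->]]; rewrite /hl /= hE; apply/phi_elt_eq0 => //; apply: he1.
    by apply/subst_idealP; exact: subst_ideal_drel.
  exact: nf_nonroute.
exists g => z; rewrite /phi_elt gE [LHS]hE.
apply/eqP; rewrite -subr_eq0 -phi_eltB -mulrBl; apply/eqP/phi_elt_eq0 => //.
by apply: ky; rewrite linearB /= nf_mule1 subrr.
Qed.

(** [y] represents the image of the generator, and x y = 1 says that this image
    generates the target. *)
Lemma mod_iso_phiP : mod_iso (Phi I k) (Phi I k') <->
  exists y, (forall z, nf k z = 0 <-> nf k' (z * y) = 0) /\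
            (exists x, nf k' (x * y) = nf k' 1).
Proof.
split=> [[f fbij]|[y [ky [x xy]]]].
  have [y Ey] := phi_eltP (f (phi_elt I k 1)).
  have fE z : f (phi_elt I k z) = phi_elt I k' (z * y).
    by rewrite -{1}[z]mulr1 !phi_eltM linearZ /= Ey.
  exists y; split=> [z|].
    rewrite -(phi_elt_eq0 I0) -(phi_elt_eq0 I0') -fE.
    split=> [->|fz0]; first exact: linear0.
    by apply: (bij_inj fbij); rewrite fz0 linear0.
  have [g _ gK] := fbij; have [x Ex] := phi_eltP (g (phi_elt I k' 1)).
  exists x; apply/eqP; rewrite -subr_eq0 -linearB; apply/eqP/(phi_elt_eq0 I0').
  by rewrite phi_eltB -fE -Ex gK subrr.
have [f fE] := @phi_hom y (fun z => proj1 (ky z)).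
exists f; apply: inj_surj_bij => [m n|m].
  have [z ->] := phi_eltP m; have [w ->] := phi_eltP n.
  move/eqP; rewrite -subr_eq0 -linearB -phi_eltB fE => /eqP/(phi_elt_eq0 I0')/ky.
  by move/(phi_elt_eq0 I0)/eqP; rewrite phi_eltB subr_eq0 => /eqP.
have [z ->] := phi_eltP m; exists (phi_elt I k (z * x)); rewrite fE -mulrA.
apply/eqP; rewrite -subr_eq0 -phi_eltB -[X in _ - X]mulr1 -mulrBr.
apply/eqP/(phi_elt_eq0 I0')/nf0_mul.
by rewrite linearB /= xy subrr.
Qed.
End Homomorphisms.

(** * The system as a condition on one element *)

Section System.
Variables (G : quiver) (p : qpath G).
Local Notation e1 := (pid (pbeg p)).

Lemma vpath_inj (d : detours p) : injective (@vpath G p d).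
Proof. by move=> i j /val_inj/val_inj. Qed.

Lemma wpath_inj : injective (@wpath G p).
Proof. by move=> i j /val_inj/val_inj. Qed.

Definition top_elt (R : comNzRingType) (z : Zidx p -> R) : pathAlg R G :=
  pelt e1 + \sum_j z j *: pelt (wpath j).

(** The shape that both sides of the equation of a detour have before and after
    the reduction, so that the v_i of this detour suffice to expand them. *)
Definition past_detour (d : detours p) (w : qpath G) : Prop :=
  pend w = tgt (darrow d) /\ (plen (dpath d) < plen w)%N.

Section Coefficients.
Variables (R : comNzRingType) (c : Xidx p -> R) (d : detours p).
Implicit Types (x y : pathAlg R G).

Lemma nf_past_detour x : pa_in (past_detour d) x ->
  nf c x = \sum_(i : Idx d) pcoef (nf c x) (vpath i) *: pelt (vpath i).
Proof.
move=> xd; apply: pa_in_sumE (@vpath_inj d) _.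
apply: pa_in_lin xd => q [eq lq]; rewrite -pa_lin_pelt.
apply: pa_inW (@nf_path_in _ _ _ c q) => w [wp ew lw _ _].
suff iP: (plen (dpath d) < plen (ssval (SeqSub wp)))%N
    && (pend (ssval (SeqSub wp)) == tgt (darrow d)).
  by exists (exist _ (SeqSub wp) iP).
by rewrite /= ew eq eqxx andbT; exact: leq_trans lw.
Qed.

Lemma past_detour_mul x y : pa_in (past_detour d) x ->
  pa_in (past_detour d) (x * y).
Proof.
move=> xd; apply: (@pa_in_mul _ _ _ (fun=> True)) xd _ => // q r w [eq lq] _ Ew.
by split; [rewrite (pend_pcomp Ew)|rewrite (plen_pcomp Ew) ltn_addl].
Qed.

Lemma past_detour_sum (a : Idx d -> R) :
  pa_in (past_detour d) (\sum_i a i *: pelt (vpath i)).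
Proof.
apply: pa_in_sum => i _; apply: pa_inZ; apply: pa_in_pelt.
by split; [exact: vpath_pend|exact: vpath_plen].
Qed.

Lemma past_detour_arrow :
  pa_in (past_detour d) (pelt (parrow (darrow d)) * pelt (dpath d) : pathAlg R G).
Proof.
rewrite mul_pelt; case Ew: (pcomp _ _) => [w|] /=; last exact: pa_in0.
apply: pa_in_pelt; split; first exact: pend_arrow Ew.
by rewrite (plen_pcomp Ew) addn1.
Qed.
End Coefficients.

Variable K : fieldType.
Local Notation KXYZ := (polyring K (XYZ p)).
Local Notation Y := (@Yvar K G p).

Lemma expands_toP (d : detours p) (x : pathAlg KXYZ G) (a : Idx d -> KXYZ) :
  expands_to x a <-> nf Y x = \sum_i a i *: pelt (vpath i).
Proof.
have nfa : nf Y (\sum_i a i *: pelt (vpath i)) = \sum_i a i *: pelt (vpath i).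
  apply: nf_id; apply: pa_in_sum => i _; apply: pa_inZ; apply: pa_in_pelt.
  exact: vpath_rsubs.
rewrite /expands_to subst_idealP linearB /= nfa.
by split=> [/eqP|->]; [rewrite subr_eq0 => /eqP|rewrite subrr].
Qed.

(** Both sides are expanded by normal forms with generic parameters, which by
    uniqueness are the only expansions; evaluation at the point turns them into
    normal forms over the field, and their difference is the detour relation
    multiplied by the top element. *)
Lemma Sp_consistentP (k k' : Xidx p -> K) :
  Sp_consistent k k' <->
  exists z, forall d, nf k' (drel k d * top_elt z) = 0.
Proof.
have evalE z x d (i : Idx d) :
    peval (point k k' z) (pcoef (nf Y x) (vpath i))
    = pcoef (nf k' (pa_map (peval (point k k' z)) x)) (vpath i).
  rewrite -(@pa_map_nf _ _ _ _ (peval (point k k' z)) Y) ?pcoef_map //.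
  by move=> y; exact: peval_pvar.
have evalTop z : pa_map (peval (point k k' z)) (top_gen K p) = top_elt z.
  rewrite /top_gen pa_mapD pa_map_pelt pa_map_sum; congr (_ + _).
  by apply: eq_bigr => j _; rewrite pa_mapZ pa_map_pelt [X in X *: _]peval_pvar.
have evalL z d : pa_map (peval (point k k' z)) (sys_lhs K d)
    = (\sum_(i : Idx d) k (Tagged (@Idx _ p) i) *: pelt (vpath i)) * top_elt z.
  rewrite /sys_lhs pa_mapM evalTop pa_map_sum; congr (_ * _).
  by apply: eq_bigr => i _; rewrite pa_mapZ pa_map_pelt [X in X *: _]peval_pvar.
have evalR z d : pa_map (peval (point k k' z)) (sys_rhs K d)
    = pelt (parrow (darrow d)) * pelt (dpath d) * top_elt z.
  by rewrite /sys_rhs !pa_mapM evalTop !pa_map_pelt.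
split=> [] [z zP]; exists z.
  move=> d; rewrite mulrBl linearB /=; apply/eqP; rewrite subr_eq0; apply/eqP.
  rewrite -evalL -evalR (@nf_past_detour _ _ d); last first.
    by rewrite evalR; apply: past_detour_mul; exact: past_detour_arrow.
  rewrite [RHS](@nf_past_detour _ _ d); last first.
    by rewrite evalL; apply: past_detour_mul; exact: past_detour_sum.
  apply: eq_bigr => i _; congr (_ *: _); rewrite -!evalE; apply/esym.
  apply: (zP (_, _)); exists d.
  exists (fun i => pcoef (nf Y (sys_lhs K d)) (vpath i)).
  exists (fun i => pcoef (nf Y (sys_rhs K d)) (vpath i)).
  split; last by exists i.
    apply/expands_toP/nf_past_detour/past_detour_mul; exact: past_detour_sum.
  apply/expands_toP/nf_past_detour/past_detour_mul; exact: past_detour_arrow.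
move=> _ [d [a [b [/expands_toP Ea /expands_toP Eb [i ->]]]]] /=.
rewrite -(pcoef_sum_inj a i (@vpath_inj d)) -(pcoef_sum_inj b i (@vpath_inj d)).
rewrite -Ea -Eb !evalE evalL evalR; congr pcoef.
have /eqP := zP d; rewrite mulrBl linearB subr_eq0 => /eqP/esym; exact: id.
Qed.
End System.

(** * Generators of the form e1 plus longer paths *)

Section Unipotent.
Variables (K : fieldType) (G : quiver) (p : qpath G) (k k' : Xidx p -> K).
Local Notation A := (pathAlg K G).
Local Notation e1 := (pid (pbeg p)).
Implicit Types (x y z m f : A).

(** If [q] starts in e1, its products with the paths in [f] are again no routes;
    otherwise these products are zero. *)
Lemma mul_nonroute q f : pa_in (fun w => pend w = pbeg p) f -> ~~ route p q ->
  nf k' (pelt q * f) = 0.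
Proof.
move=> + nq; elim/pa_in_ind: f / => [|f g ef eg|a w ew].
- by rewrite mulr0 linear0.
- by rewrite mulrDr linearD /= ef eg addr0.
rewrite pa_scaleAr linearZ /= mul_pelt.
case: (eqVneq (pend w) (pbeg q)) => [eq|ne].
  have [r Er] := pcomp_some eq; rewrite Er /= nf_nonroute ?scaler0 //.
  by apply: routePn_pcomp Er nq _; rewrite -eq.
by rewrite pcomp_none //= linear0 scaler0.
Qed.

(** It suffices to test generators of the ideal, and the non-routes pass the test
    for every [y] that ends in e1.  This is why the system has equations for the
    detours only. *)
Lemma subst_ideal_mul y : pa_in (fun w => pend w = pbeg p) y ->
  (forall d, nf k' (drel k d * y) = 0) ->
  forall z, nf k z = 0 -> nf k' (z * y) = 0.
Proof.
move=> yp dy z /subst_idealP; elim/span_ind: z / => [|x z /= ex ez|x z Sz].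
- by rewrite mul0r linear0.
- by rewrite mulrDl linearD /= ex ez addr0.
rewrite -[x *: z]/(x * z) -mulrA; apply: nf0_mul.
by case: Sz => [[q nq ->]|[d ->]]; [exact: mul_nonroute|exact: dy].
Qed.

(** The partial sums of the geometric series for 1 / (1 + m) are left inverses up
    to an error of arbitrarily large length, which the normal form kills. *)
Lemma left_inverse_unipotent m : pa_in (fun q => 0 < plen q)%N m ->
  exists x, nf k' (x * (pelt e1 + m)) = nf k' 1.
Proof.
move=> m0.
have [x [e le xE]] : exists x, exists2 e,
    pa_in (fun q => plen p < plen q)%N e & x * (1 + m) = 1 + e.
  elim: (plen p).+1 => [|n [x [e le xE]]].
    exists 0, (-1); last by rewrite mul0r subrr.
    by apply: (@pa_inW _ _ (fun=> True)) => // q.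
  (* (x - e)(1 + m) = 1 + e - e - e m, and e m is longer than e *)
  exists (x - e), (- (e * m)); last first.
    by rewrite mulrBl xE mulrDr mulr1 addrKA.
  rewrite -mulrN; apply: (@pa_in_mul _ _ _ (fun q => 0 < plen q)%N) le _.
    move=> q r w lq lr /plen_pcomp->.
    by rewrite -add1n leq_add.
  by rewrite -scaleN1r; exact: pa_inZ.
exists x; rewrite mulrDr linearD /= nf_mule1 -linearD /= -[X in X + _]mulr1 -mulrDr.
by rewrite xE linearD /= (nf_long _ le) addr0.
Qed.

(** A shortest path in [f] keeps its coefficient in the product, and right
    subpaths of [p] are told apart by their lengths. *)
Lemma unipotent_inj m f : pa_in (fun q => 0 < plen q)%N m ->
  pa_in (fun w => w \in rsubs p) f -> nf k' (f * (pelt e1 + m)) = 0 -> f = 0.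
Proof.
move=> m0 fp fy; apply/pathAlgP => w; rewrite pcoef0; apply/eqP.
apply: contraTT isT => fw0.
have [n] := ubnP (plen w); elim: n w fw0 => // n IHn w fw0; rewrite ltnS => lw.
have f_w : pa_in (fun v => plen w < plen v)%N (f - pcoef f w *: pelt w).
  move=> v; rewrite -scaleNr pcoefD pcoefZ pcoef_pelt.
  case: (eqVneq w v) => [<-|nvw]; first by rewrite mulr1 subrr eqxx.
  rewrite mulr0 addr0 => fv; rewrite ltnNge; apply/negP => lv.
  have: (plen v < n)%N.
    rewrite (leq_trans _ lw) // ltn_neqAle lv andbT.
    by apply: contraNneq nvw => /esym/(rsubs_plen_inj (fp _ fw0) (fp _ fv))->.
  by move/(IHn _ fv).
set a := pcoef f w in fw0 f_w; set g := f - a *: pelt w in f_w.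
pose r := g * (pelt e1 + m) + a *: pelt w * m.
have r_w : pa_in (fun v => plen w < plen v)%N r.
  apply: pa_inD.
    apply: (@pa_in_mul _ _ _ (fun=> True)) f_w _ => // q u v lq _ /plen_pcomp->.
    by rewrite ltn_addl.
  apply: (@pa_in_mul _ _ (fun q => q = w)) m0 => [_ u v -> lu /plen_pcomp->|].
    by rewrite -[X in (X < _)%N]add0n ltn_add2r.
  by apply: pa_inZ; exact: pa_in_pelt.
have fyE : f * (pelt e1 + m) = a *: pelt w + r.
  have we1 : pelt w * pelt e1 = pelt w :> A.
    by rewrite mul_pelt pcomp_pidr (rsubs_pbeg (fp _ fw0)) eqxx.
  rewrite -[f in LHS](subrK (a *: pelt w)) -/g mulrDl [X in _ + X]mulrDr.
  by rewrite [X in _ + (X + _)]pa_scaleAl we1 addrCA.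
move: fy; rewrite fyE linearD linearZ /= nf_rsub; last exact: fp fw0.
move/(congr1 (fun x => pcoef x w)); rewrite pcoefD pcoefZ pcoef_pelt eqxx mulr1.
have -> : pcoef (nf k' r) w = 0.
  by apply/eqP; apply: contraTT isT => /(nf_in_plen r_w); rewrite ltnn.
by rewrite pcoef0 addr0 => a0; rewrite a0 eqxx in fw0.
Qed.

(** A solution gives the generator [top_elt z], to which unitriangularity applies.
    Conversely the normal form of a generator ends in e1, its coefficient at e1
    is nonzero, and scaling this coefficient to 1 gives a solution. *)
Lemma unipotent_generatorP :
  (exists z : Zidx p -> K, forall d, nf k' (drel k d * top_elt z) = 0) <->
  (exists y, (forall z, nf k z = 0 <-> nf k' (z * y) = 0) /\
             (exists x, nf k' (x * y) = nf k' 1)).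
Proof.
split=> [[z zP]|[y [ky [x xy]]]].
  pose m : A := \sum_j z j *: pelt (wpath j).
  have m0 : pa_in (fun q => 0 < plen q)%N m.
    apply: pa_in_sum => j _; apply: pa_inZ; apply: pa_in_pelt.
    by case/andP: (valP j).
  have top1 : pa_in (fun w => pend w = pbeg p) (top_elt z).
    apply: pa_inD; first exact: pa_in_pelt.
    apply: pa_in_sum => j _; apply: pa_inZ; apply: pa_in_pelt.
    by case/andP: (valP j) => _ /eqP.
  have ker := subst_ideal_mul top1 zP.
  exists (top_elt z); split; last exact: left_inverse_unipotent.
  move=> x; split; first exact: ker.
  move=> xy0; apply: (unipotent_inj m0 (@nf_in_rsubs _ _ _ k x)).
  rewrite -[nf k x](subrK x) mulrDl linearD /= -/(top_elt z) xy0 addr0.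
  by apply: ker; rewrite linearB /= nf_nf subrr.
pose g := nf k' y.
(* 1 - e1 lies in L(k), hence multiplies y into L(k') *)
have gE : pelt e1 * g = g.
  rewrite -nf_pidM; apply/eqP; rewrite eq_sym -subr_eq0 -linearB /=.
  rewrite -[X in X - _]mul1r -mulrBl; apply/eqP/ky.
  by rewrite linearB /= nf_one nf_rsub ?subrr // rsubs_pid.
have gend : pa_in (fun w => pend w = pbeg p) g.
  rewrite -gE; apply: (@pa_in_mul _ _ (fun q => q = pid (pbeg p)) (fun=> True)).
  - by move=> _ r w -> _ /pend_pcomp.
  - exact: pa_in_pelt.
  - by [].
have nfg u : nf k' (u * g) = nf k' (u * y) by exact: nf_mul_nf.
pose y0 := pcoef g e1.
(* otherwise e1 would not occur in the normal form of any multiple of g, whereas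
   the normal form of x g is e1 *)
have y0n : y0 != 0.
  apply/eqP => y00; have gpos : pa_in (fun q => 0 < plen q)%N g.
    move=> w gw; have wp := nf_in_rsubs gw.
    rewrite lt0n; apply: contraNneq gw => lw.
    by rewrite (@rsubs_plen_inj _ p w e1) ?rsubs_pid // -/y0 y00.
  have /nf_in_plen : pa_in (fun q => 1 <= plen q)%N (x * g).
    apply: (@pa_in_mul _ _ (fun=> True)) gpos => // q r w _ lr /plen_pcomp->.
    by rewrite ltn_addr.
  move=> /(_ _ k' e1); rewrite nfg xy nf_one pcoef_pelt eqxx => /(_ (oner_neq0 _)).
  by [].
have gw : pa_in (fun q => exists j, q = @wpath G p j) (g - y0 *: pelt e1).
  move=> w; rewrite -scaleNr pcoefD pcoefZ pcoef_pelt.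
  case: (eqVneq e1 w) => [<-|ne]; first by rewrite mulr1 subrr eqxx.
  rewrite mulr0 addr0 => gw; have wp := nf_in_rsubs gw.
  have wj : (0 < plen (ssval (SeqSub wp)))%N && (pend (ssval (SeqSub wp)) == pbeg p).
    rewrite /= (gend _ gw) eqxx andbT lt0n; apply: contraNneq ne => lw.
    by rewrite (@rsubs_plen_inj _ p w e1) ?rsubs_pid.
  by exists (exist _ (SeqSub wp) wj).
pose z (j : Zidx p) : K := y0^-1 * pcoef (g - y0 *: pelt e1) (wpath j).
have gtop : g = y0 *: @top_elt G p K z.
  rewrite /top_elt scalerDr scaler_sumr -[LHS](subrK (y0 *: pelt e1)) addrC.
  congr (_ + _); rewrite {1}(pa_in_sumE (@wpath_inj G p) gw).
  by apply: eq_bigr => j _; rewrite scalerA mulVKf.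
exists z => d.
apply: (scalerI y0n); rewrite scaler0.
have := nfg (drel k d); rewrite gtop pa_scaleAr linearZ /= => ->.
by apply/ky/subst_idealP; exact: subst_ideal_drel.
Qed.
End Unipotent.

Theorem theoremB (K : fieldType) (G : quiver) (I : ideal (pathAlg K G))
    (L : nat) (p : qpath G) (s : nat) (t : 'I_s -> pathAlg K G)
    (k k' : Xidx p -> K) :
  admissible I -> loewy_length (quotring I) L -> spans_upto I L t ->
  Vp t k -> Vp t k' ->
  (Sp_consistent k k' <-> mod_iso (Phi I k) (Phi I k')).
Proof.
move=> adI loewyL spant Vk Vk'.
rewrite Sp_consistentP unipotent_generatorP mod_iso_phiP //.
- by move=> z; exact: (nf_ideal adI loewyL spant Vk).
- by move=> z; exact: (nf_ideal adI loewyL spant Vk').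
Qed.
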